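(* Let $\Gamma$ be a finite connected graph of genus $d=|E|-|V|+1$. For $k,\ell\in\mathbb{N}$ let $\eta^{k,\ell}(\Gamma)$ be the Euler characteristic of the subcomplex $I^{k,\ell}\mathfrak{C}^{\bullet}(\Gamma)$ of the CKS complex. Then $$T_\Gamma\big(1,\,-(x+y+xy)\big)=(-1)^d\sum_{k,\ell\in\mathbb{N}}\eta^{k,\ell}(\Gamma)\,x^{d-k}y^\ell,$$ where $T_\Gamma$ is the Tutte polynomial of $\Gamma$.
   Context: A graph $\Gamma$ is a finite connected oriented multigraph, loops allowed: finite sets $V$, $E$ and maps $h,t:E\to V$. A bond is a minimal set of edges whose removal increases the number of connected components. $F_p(\Gamma)$ is the set of $p$-element subsets $S\subseteq E$ containing no bond. $\Gamma\setminus S$ is the graph with the edges in $S$ deleted. $\mathrm{H}_1(\Gamma)=\ker(\mathbb{Z}^E\to\mathbb{Z}^V,\ e\mapsto h(e)-t(e))$ and $\mathrm{H}^1(\Gamma)$ is the cokernel of the transpose $\mathbb{Z}^V\to\mathbb{Z}^E$; $[e]\in \mathrm{H}^1(\Gamma)$ is the class of $e\in E$, and it defines the functional on $\mathrm{H}_1(\Gamma)$ given by the $e$-coordinate. Tutte polynomial: $T_\Gamma(x,y)=\sum_{S\subseteq E}(x-1)^{k(S)-k(E)}(y-1)^{k(S)+|S|-|V|}$, where $k(S)$ is the number of connected components of the graph $(V,S)$. CKS complex: $\mathfrak{C}^{2p,q,r}(\Gamma)=\bigoplus_{S\in F_p(\Gamma)}\bigwedge^q \mathrm{H}_1(\Gamma\setminus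 S)\otimes\bigwedge^r \mathrm{H}^1(\Gamma\setminus S)$, with differential $\mathfrak{C}^{2p,q,r}\to\mathfrak{C}^{2p+2,q-1,r}$ whose component from the summand of $S$ to the summand of $S\cup e$ (for $e\in E\setminus S$ with $S\cup e\in F_{p+1}(\Gamma)$) is the tensor product of the interior product $\iota_e:\bigwedge^q \mathrm{H}_1(\Gamma\setminus S)\to\bigwedge^{q-1}\mathrm{H}_1(\Gamma\setminus S\setminus e)$ with $[e]\in \mathrm{H}^1(\Gamma\setminus S)$ and the map induced by the natural projection $\mathrm{H}^1(\Gamma\setminus S)\to \mathrm{H}^1(\Gamma\setminus S\setminus e)$. The subcomplex $I^{k,\ell}\mathfrak{C}^\bullet(\Gamma)$ is $I^{k,\ell}\mathfrak{C}^p(\Gamma)=\mathfrak{C}^{2p,k-p,\ell}(\Gamma)$, with differential of degree $1$ in $p$; its Euler characteristic is $\eta^{k,\ell}(\Gamma)=\sum_p(-1)^p\operatorname{rank}_{\mathbb{Z}}\mathrm{H}^p(I^{k,\ell}\mathfrak{C}^\bullet(\Gamma))$. *)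

(* Defs.v *)
From HB Require Import structures.
From mathcomp Require Import all_boot all_order all_algebra.
From mathcomp Require Import generic_quotient ring_quotient.
From mathcomp Require Import boolp classical_sets.
From mathcomp Require Import freeg mpoly.

Set Implicit Arguments.
Unset Strict Implicit.
Unset Printing Implicit Defensive.

Import Order.TTheory GRing.Theory Num.Theory.
Local Open Scope ring_scope.
Local Open Scope quotient_scope.

Inductive zspan (M : zmodType) (R : M -> Prop) : M -> Prop :=
| zspan0 : zspan R 0
| zspanB x y : zspan R x -> zspan R y -> zspan R (x - y)
| zspan_gen x : R x -> zspan R x.

Definition zspanp (M : zmodType) (R : M -> Prop) : {pred M} :=
  fun x => `[< zspan R x >].

Fact zspanp_zmod_closed (M : zmodType) (R : M -> Prop) : zmod_closed (zspanp R).
Proof.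
split=> [|x y /asboolP Rx /asboolP Ry]; apply/asboolP; first exact: zspan0.
exact: zspanB.
Qed.

HB.instance Definition _ (M : zmodType) (R : M -> Prop) :=
  GRing.isZmodClosed.Build M (zspanp R) (zspanp_zmod_closed R).

(* The quotient of M by the subgroup generated by the elements satisfying R. *)
Definition quotby (M : zmodType) (R : M -> Prop) : zmodType :=
  Quotient.quot (zspanp R).

Definition class_of (M : zmodType) (R : M -> Prop) (x : M) : quotby R :=
  \pi_(Quotient.quot (zspanp R)) x.

Definition repr_of (M : zmodType) (R : M -> Prop) (x : quotby R) : M :=
  @repr M (Quotient.quot (zspanp R)) x.

Definition presented (T : choiceType) (R : {freeg T / int} -> Prop) : zmodType :=
  quotby R.

Definition pres_gen (T : choiceType) (R : {freeg T / int} -> Prop) (t : T) :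
  presented R := class_of R << t >>.

(* pres_lift f extends f from the generators to the presented group; it is a
   group morphism as soon as the extension of f to the free abelian group kills
   the relators.  zmodule M is M with its int-module structure. *)
Definition pres_lift (T : choiceType) (R : {freeg T / int} -> Prop)
    (M : zmodType) (f : T -> M) (x : presented R) : M :=
  fglift (f : T -> zmodule M) (repr_of x).

Definition indep (M : zmodType) (n : nat) (x : 'I_n -> M) : Prop :=
  forall c : 'I_n -> int, \sum_i x i *~ c i = 0 -> forall i, c i = 0.

(* The rank over Z of a subgroup P: the largest number of Z-linearly
   independent elements of P (0 by convention if there is no largest one). *)
Definition is_zrank (M : zmodType) (P : M -> Prop) (n : nat) : Prop :=
  (exists x : 'I_n -> M, (forall i, P (x i)) /\ indep x) /\
  (forall m (x : 'I_m -> M), (forall i, P (x i)) -> indep x -> (m <= n)%N).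

Definition zrank (M : zmodType) (P : M -> Prop) : nat :=
  xget 0%N (is_zrank P).

Definition dsum (I : finType) (M : I -> zmodType) : Type :=
  {dffun forall i : I, M i}.

HB.instance Definition _ (I : finType) (M : I -> zmodType) :=
  Choice.on (dsum M).

Section DirectSum.
Variables (I : finType) (M : I -> zmodType).
Implicit Types x y z : dsum M.

Definition dsum_zero : dsum M := [ffun i => 0 : M i].
Definition dsum_opp x : dsum M := [ffun i => - x i].
Definition dsum_add x y : dsum M := [ffun i => x i + y i].

Fact dsum_addA : associative dsum_add.
Proof. by move=> x y z; apply/ffunP=> i; rewrite !ffunE addrA. Qed.
Fact dsum_addC : commutative dsum_add.
Proof. by move=> x y; apply/ffunP=> i; rewrite !ffunE addrC. Qed.
Fact dsum_add0 : left_id dsum_zero dsum_add.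
Proof. by move=> x; apply/ffunP=> i; rewrite !ffunE add0r. Qed.
Fact dsum_addN : left_inverse dsum_zero dsum_opp dsum_add.
Proof. by move=> x; apply/ffunP=> i; rewrite !ffunE addNr. Qed.

HB.instance Definition _ :=
  GRing.isZmodule.Build (dsum M) dsum_addA dsum_addC dsum_add0 dsum_addN.
End DirectSum.

Inductive tens_rel (M N : zmodType) : {freeg (M * N)%type / int} -> Prop :=
| tens_addl a a' b :
    tens_rel (<< (a + a', b) >> - << (a, b) >> - << (a', b) >>)
| tens_addr a b b' :
    tens_rel (<< (a, b + b') >> - << (a, b) >> - << (a, b') >>).

Definition tensor (M N : zmodType) : zmodType := presented (@tens_rel M N).

Definition tens (M N : zmodType) (a : M) (b : N) : tensor M N :=
  pres_gen (@tens_rel M N) (a, b).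

Definition tens_map (M N M' N' : zmodType) (f : M -> M') (g : N -> N') :
    tensor M N -> tensor M' N' :=
  pres_lift (fun ab : M * N => tens (f ab.1) (g ab.2)).

Definition upd (q : nat) (M : zmodType) (v : {ffun 'I_q -> M}) (i : 'I_q)
    (a : M) : {ffun 'I_q -> M} :=
  [ffun j => if j == i then a else v j].

Inductive ext_rel (q : nat) (M : zmodType) :
    {freeg {ffun 'I_q -> M} / int} -> Prop :=
| ext_add (v : {ffun 'I_q -> M}) i a b :
    ext_rel (<< upd v i (a + b) >> - << upd v i a >> - << upd v i b >>)
| ext_alt (v : {ffun 'I_q -> M}) i j : i != j -> v i = v j -> ext_rel << v >>.

Definition ext (q : nat) (M : zmodType) : zmodType := presented (@ext_rel q M).

Definition wedge (q : nat) (M : zmodType) (v : {ffun 'I_q -> M}) : ext q M :=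
  pres_gen (@ext_rel q M) v.

Definition ext_map (q : nat) (M N : zmodType) (f : M -> N) :
    ext q M -> ext q N :=
  pres_lift (fun v : {ffun 'I_q -> M} => wedge [ffun i => f (v i)]).

Definition iprod (q : nat) (M : zmodType) (a : M -> int) :
    ext q.+1 M -> ext q M :=
  pres_lift (fun v : {ffun 'I_q.+1 -> M} =>
    \sum_i wedge [ffun j => v (fintype.lift i j)] *~ ((-1) ^+ i * a (v i))).

Record mgraph := MGraph {
  vertex : finType;
  edge : finType;
  ehead : edge -> vertex;
  etail : edge -> vertex
}.

Definition adj (G : mgraph) (S : {set edge G}) : rel (vertex G) :=
  fun u v => [exists e in S, ((ehead e == u) && (etail e == v))
                          || ((ehead e == v) && (etail e == u))].

Definition ncomp (G : mgraph) (S : {set edge G}) : nat :=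
  n_comp (adj S) (vertex G).

Definition connected (G : mgraph) : Prop := ncomp [set: edge G] = 1%N.

(* The truncated subtraction is exact on connected graphs. *)
Definition genus (G : mgraph) : nat := (#|edge G|.+1 - #|vertex G|)%N.

Definition bond (G : mgraph) (B : {set edge G}) : bool :=
  minset [pred A : {set edge G} | (ncomp [set: edge G] < ncomp (~: A))%N] B.

Definition bondfree (G : mgraph) (p : nat) : {set {set edge G}} :=
  [set S : {set edge G} | (#|S| == p)
     && [forall B : {set edge G}, bond B ==> ~~ (B \subset S)]].

Definition del (G : mgraph) (S : {set edge G}) : mgraph :=
  @MGraph (vertex G) {e : edge G | e \notin S}
    (fun e => ehead (val e)) (fun e => etail (val e)).

(* Both subtractions are exact, as k(S) >= k(E) and k(S) + |S| >= |V|. *)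
Definition tutte (G : mgraph) : {mpoly int[2]} :=
  \sum_(S : {set edge G})
    ('X_ord0 - 1) ^+ (ncomp S - ncomp [set: edge G])
    * ('X_ord_max - 1) ^+ (ncomp S + #|S| - #|vertex G|).

Section Homology.
Variable G : mgraph.

Definition incidence (e : edge G) (v : vertex G) : int :=
  (ehead e == v)%:R - (etail e == v)%:R.

Definition bdry (z : {ffun edge G -> int}) : {ffun vertex G -> int} :=
  [ffun v => \sum_e z e * incidence e v].

Definition cobdry (f : {ffun vertex G -> int}) : {ffun edge G -> int} :=
  [ffun e => \sum_v f v * incidence e v].

Definition cycles : {pred {ffun edge G -> int}} := fun z => bdry z == 0.

Fact cycles_zmod_closed : zmod_closed cycles.
Proof.
split=> [|x y /eqP/ffunP x0 /eqP/ffunP y0]; apply/eqP/ffunP=> v.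
  by rewrite !ffunE big1 // => e _; rewrite ffunE mul0r.
move: (x0 v) (y0 v); rewrite !ffunE => xv yv.
under eq_bigr do rewrite !ffunE mulrBl.
by rewrite sumrB xv yv subrr.
Qed.

HB.instance Definition _ :=
  GRing.isZmodClosed.Build {ffun edge G -> int} cycles cycles_zmod_closed.

Record H1_type := H1Cycle {
  H1val :> {ffun edge G -> int};
  _ : H1val \in cycles
}.
HB.instance Definition _ := [isSub for H1val].
HB.instance Definition _ := [Choice of H1_type by <:].
HB.instance Definition _ := [SubChoice_isSubZmodule of H1_type by <:].

Definition H1 : zmodType := H1_type.

Definition Hc1 : zmodType :=
  quotby (fun x => exists f : {ffun vertex G -> int}, x = cobdry f).

End Homology.

Section CKS.
Variable G : mgraph.
Implicit Types S : {set edge G}.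

(* The e-coordinate of x, read as 0 when e has been deleted. *)
Definition coord S (x : {ffun edge (del S) -> int}) (e : edge G) : int :=
  oapp x 0 (insub e).

(* Extension by zero if S' \subset S, restriction if S \subset S'. *)
Definition recoord S S' (x : {ffun edge (del S) -> int}) :
    {ffun edge (del S') -> int} :=
  [ffun e : edge (del S') => coord x (val e)].

Fact recoord_cycles S S' (x : {ffun edge (del S) -> int}) :
  S' \subset S -> x \in @cycles (del S) ->
  recoord S' x \in @cycles (del S').
Proof.
have sumE T (F : edge G -> int) :
    \sum_(e : edge (del T)) F (val e) = \sum_(e | e \notin T) F e.
  rewrite (reindex_omap (fun e : edge (del T) => val e) insub) /=.
    by apply: eq_bigl => e; rewrite (valP e) valK eqxx.
  by move=> e eT; rewrite insubT.
move=> sub /eqP/ffunP xc; apply/eqP/ffunP=> v; move: (xc v); rewrite !ffunE.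
pose F e := coord x e * @incidence G e v => xv; rewrite -[RHS]xv.
transitivity (\sum_(e : edge (del S')) F (val e)).
  by apply: eq_bigr => e _; rewrite ffunE.
transitivity (\sum_(e : edge (del S)) F (val e)); last first.
  by apply: eq_bigr => e _; rewrite /F /coord valK.
rewrite !sumE [LHS](bigID (fun e => e \in S)) /= big1 ?add0r.
  apply: eq_bigl => e; case eS: (e \in S); rewrite ?andbF ?andbT //.
  by apply: contraFN eS; apply: (fintype.subsetP sub).
by move=> e /andP[_ eS]; rewrite /F /coord insubF ?mul0r ?eS.
Qed.

Definition H1_incl S S' (sub : S' \subset S) (z : H1 (del S)) : H1 (del S') :=
  H1Cycle (recoord_cycles sub (valP z)).

Definition Hc1_proj S S' (c : Hc1 (del S)) : Hc1 (del S') :=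
  class_of _ (recoord S' (repr_of c)).

(* iota_e for e \in S, from Gamma \ (S \ e) to Gamma \ S: the interior product
   by the e-coordinate, whose values lie in the exterior power of
   H_1(Gamma \ S), which embeds into that of H_1(Gamma \ (S \ e)). *)
Definition iota (q : nat) S (e : edge G) (w : ext q.+1 (H1 (del (S :\ e)))) :
    ext q (H1 (del S)) :=
  xget 0 (fun w' : ext q (H1 (del S)) =>
    ext_map (H1_incl (subD1set S e)) w'
      = iprod (fun z : H1 (del (S :\ e)) => coord (val z) e) w).

Definition cks_summand (q r : nat) S : zmodType :=
  tensor (ext q (H1 (del S))) (ext r (Hc1 (del S))).

Definition cks_comp (q r : nat) S (e : edge G) :
    cks_summand q.+1 r (S :\ e) -> cks_summand q r S :=
  tens_map (@iota q S e) (ext_map (@Hc1_proj (S :\ e) S)).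

Definition bf (p : nat) : finType := {S : {set edge G} | S \in bondfree G p}.

Fact bondfreeD1 p (S : bf p.+1) (e : {e : edge G | e \in val S}) :
  val S :\ val e \in bondfree G p.
Proof.
case: e (valP S) => e /= eS; move: (val S) eS => T eT.
rewrite !inE => /andP[/eqP cT /forallP bT].
have := cardsD1 e T; rewrite cT eT add1n => -[<-]; rewrite eqxx /=.
apply/forallP=> B; apply/implyP=> bB; apply: contra (implyP (bT B) bB) => BT.
exact: fintype.subset_trans BT (subD1set T e).
Qed.

Definition bf_del p (S : bf p.+1) (e : {e : edge G | e \in val S}) : bf p :=
  Sub (val S :\ val e) (bondfreeD1 e).

(* cks p q r is the group in degree (2p, q, r). *)
Definition cks (p q r : nat) : zmodType :=
  dsum (fun S : bf p => cks_summand q r (val S)).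

Definition cks_diff (p q r : nat) (x : cks p q.+1 r) : cks p.+1 q r :=
  [ffun S : bf p.+1 =>
     \sum_(e : {e : edge G | e \in val S}) cks_comp (x (bf_del e))].

(* The differential vanishes on degree q = 0, and nothing maps to p = 0. *)
Definition cocycle (p q r : nat) : cks p q r -> Prop :=
  match q with
  | 0 => fun _ => True
  | q'.+1 => fun x => cks_diff x = 0
  end.

Definition coboundary (p q r : nat) : cks p q r -> Prop :=
  match p with
  | 0 => fun x => x = 0
  | p'.+1 => fun x => exists y : cks p' q.+1 r, cks_diff y = x
  end.

(* The cohomology at cks p q r, as a subgroup of the quotient by coboundaries. *)
Definition cohomology (p q r : nat) : quotby (@coboundary p q r) -> Prop :=
  fun c => exists2 z, cocycle z & c = class_of _ z.

(* The term of degree p of I^{k,l} is cks p (k - p) l, which is 0 for p > k. *)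
Definition eta (k l : nat) : int :=
  \sum_(p < k.+1) (-1) ^+ p * (zrank (@cohomology p (k - p) l))%:Z.

End CKS.

(* Main.v *)
Require Import Defs.
From HB Require Import structures.
From mathcomp Require Import all_boot all_order all_algebra all_fingroup.
From mathcomp Require Import freeg mpoly.
From mathcomp Require Import zify ring.
From mathcomp Require generic_quotient ring_quotient boolp classical_sets.

(** A deletion set S is bond-free iff the complement of S is a connected spanning
subgraph. Then H_1 and H^1 of Gamma \ S have rank d - |S|, so the summand of S in
bidegree (q, r) has rank C(d - |S|, q) C(d - |S|, r). As the differential
squares to zero (interior products anticommute), the Euler characteristic of the
cohomology is that of the complex:
  eta^{k,l} = sum_p (-1)^p |F_p| C(d - p, k - p) C(d - p, l).
On the other side, putting 1 for the first variable of the Tutte polynomial leaves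
the connected spanning subgraphs, so T(1, 1 + u) = sum_p |F_p| u^(d - p), and
1 + u = -(x + y + xy) means u = -(1 + x)(1 + y); expand by the binomial theorem.

Ranks are computed after tensoring with Q, that is, up to torsion, without proving
that the groups are free. *)

Import Defs GRing.Theory Num.Theory.
Set Implicit Arguments.
Unset Strict Implicit.
Unset Printing Implicit Defensive.
Local Open Scope ring_scope.

(** * Presented groups, tensor products and exterior powers *)

(** The delicate object is [iota]. Contraction by the e-coordinate lands in the exterior power of
    H_1(Gamma \ (S \ e)), while the differential needs a value in that of H_1(Gamma \ S), so [iota]
    merely chooses a preimage. Existence and uniqueness both come from a cycle c with e-coordinate
    1, available because deleting S leaves the graph connected: z - z_e c retracts the larger H_1
    onto the smaller, so the exterior powers inject, and this projection fixes every contraction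
    because contraction squares to zero. A second obstacle is that S \ e \ f and S \ f \ e index
    summands of different types; a double contraction whose type ignores the order makes the two
    terms of the squared differential comparable. Finally, [zrank] counts independent elements, so a
    rank is certified by a frame: elements with dual Q-valued coordinates whose common kernel is
    torsion. *)

Section ZmodMorphisms.
Variables (U V : zmodType) (f : U -> V).

Lemma zmod_morphismD : {morph f : a b / a + b} -> zmod_morphism f.
Proof.
by move=> fD a b; apply/eqP; rewrite eq_sym subr_eq -fD subrK.
Qed.

Hypothesis fB : zmod_morphism f.

Let fA : {additive U -> V} := HB.pack f (GRing.isZmodMorphism.Build _ _ f fB).

Lemma zm0 : f 0 = 0. Proof. exact: (raddf0 fA). Qed.
Lemma zmD a b : f (a + b) = f a + f b. Proof. exact: (raddfD fA). Qed.
Lemma zmN a : f (- a) = - f a. Proof. exact: (raddfN fA). Qed.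
Lemma zmMz a m : f (a *~ m) = f a *~ m. Proof. exact: (raddfMz fA). Qed.
Lemma zm_sum (I : Type) (r : seq I) (P : pred I) (F : I -> U) :
  f (\sum_(i <- r | P i) F i) = \sum_(i <- r | P i) f (F i).
Proof. exact: (raddf_sum fA). Qed.

End ZmodMorphisms.

Lemma zm_comp (U V W : zmodType) (f : V -> W) (g : U -> V) :
  zmod_morphism f -> zmod_morphism g -> zmod_morphism (f \o g).
Proof. by move=> fB gB a b /=; rewrite gB fB. Qed.

Lemma zm_opp (U V : zmodType) (f : U -> V) :
  zmod_morphism f -> zmod_morphism (fun x => - f x).
Proof. by move=> fB a b; rewrite fB opprB opprK addrC. Qed.

Lemma zm_add (U V : zmodType) (f g : U -> V) :
  zmod_morphism f -> zmod_morphism g -> zmod_morphism (fun x => f x + g x).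
Proof. by move=> fB gB a b; rewrite fB gB opprD addrACA. Qed.

Lemma zm_sub (U V : zmodType) (f g : U -> V) :
  zmod_morphism f -> zmod_morphism g -> zmod_morphism (fun x => f x - g x).
Proof. by move=> fB gB; apply: zm_add (zm_opp gB). Qed.

Lemma zm_mulz (U V : zmodType) (f : U -> V) m :
  zmod_morphism f -> zmod_morphism (fun x => f x *~ m).
Proof. by move=> fB a b; rewrite fB mulrzBl. Qed.

Lemma zm_mulzr (U V : zmodType) (v : V) (a : U -> int) :
  zmod_morphism a -> zmod_morphism (fun x => v *~ a x).
Proof. by move=> aB x y; rewrite aB mulrzBr. Qed.

Lemma subr_interchange (M : zmodType) (a b c d : M) : (a - b) - (c - d) = (a - c) - (b - d).
Proof. by rewrite opprD addrACA -opprD. Qed.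

Section Quotients.
Variables (M : zmodType) (R : M -> Prop).

Lemma class_ofB : zmod_morphism (class_of R).
Proof. exact: raddfB. Qed.

Lemma repr_ofK (c : quotby R) : class_of R (repr_of c) = c.
Proof. exact: generic_quotient.reprK. Qed.

Lemma class_of_eq0 x : class_of R x = 0 <-> zspan R x.
Proof.
rewrite -[0](zm0 class_ofB) -[x in zspan _ x]subr0; split.
  by move=> /eqP; rewrite -ring_quotient.Quotient.idealrBE => /boolp.asboolP.
by move=> Rx; apply/eqP; rewrite -ring_quotient.Quotient.idealrBE; apply/boolp.asboolP.
Qed.

Lemma class_of_rel x : R x -> class_of R x = 0.
Proof. by move=> Rx; apply/class_of_eq0/zspan_gen. Qed.

Lemma zspan_kernel (N : zmodType) (f : M -> N) :
  zmod_morphism f -> (forall x, R x -> f x = 0) ->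
  forall x, zspan R x -> f x = 0.
Proof.
move=> fB fR x; elim=> [|a b _ fa _ fb|a /fR //]; first exact: zm0.
by rewrite fB fa fb subr0.
Qed.

Section Factor.
Variables (N : zmodType) (f : M -> N).
Hypotheses (fB : zmod_morphism f) (fR : forall x, R x -> f x = 0).

(** [repr_of] picks an arbitrary representative; two choices differ by an element of the span of the
    relators, which f kills. *)
Lemma repr_of_factor x : f (repr_of (class_of R x)) = f x.
Proof.
apply/eqP; rewrite -subr_eq0 -fB; apply/eqP/(zspan_kernel fB fR)/class_of_eq0.
by rewrite class_ofB repr_ofK subrr.
Qed.

Lemma repr_of_factorB : zmod_morphism (fun c : quotby R => f (repr_of c)).
Proof.
move=> a b; rewrite -[in LHS](repr_ofK a) -[in LHS](repr_ofK b) -class_ofB.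
by rewrite repr_of_factor fB.
Qed.

End Factor.
End Quotients.

Section Presented.
Variables (T : choiceType) (R : {freeg T / int} -> Prop).

Lemma pres_ind (P : presented R -> Prop) :
  P 0 -> (forall a b, P a -> P b -> P (a - b)) ->
  (forall t, P (pres_gen R t)) -> forall a, P a.
Proof.
move=> P0 PB Pg a; rewrite -(repr_ofK a); elim/freeg_ind_dom0: (repr_of a).
  by rewrite (zm0 (@class_ofB _ R)).
have PN b : P b -> P (- b) by move=> Pb; rewrite -sub0r; apply: PB.
have PD b c : P b -> P c -> P (b + c).
  by move=> Pb Pc; rewrite -[c]opprK; apply: PB => //; apply: PN.
move=> k t D _ _ PD'; rewrite (zmD (@class_ofB _ R)); apply: (PD) => //.
have -> : << k *g t >> = << t >> *~ k :> {freeg T / int}.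
  by rewrite freegU_mulz; congr [freeg [:: (_, _)]]; rewrite intz.
rewrite (zmMz (@class_ofB _ R)); have := Pg t; rewrite /pres_gen.
move: (class_of R _) => g Pt; elim/int_ind: k => [|n IH|n IH].
- by rewrite mulr0z.
- by rewrite intS mulrzDr; apply: (PD).
- by rewrite intS opprD mulrzDr; apply: (PD) => //; rewrite mulrN1z; apply: PN.
Qed.

Lemma pres_eq (M : zmodType) (f g : presented R -> M) :
  zmod_morphism f -> zmod_morphism g ->
  (forall t, f (pres_gen R t) = g (pres_gen R t)) -> f =1 g.
Proof.
move=> fB gB fg; apply: pres_ind => // [|a b fa fb]; first by rewrite !zm0.
by rewrite fB gB fa fb.
Qed.

Section Lift.
Variables (M : zmodType) (f : T -> M).

Lemma fglift_zm : zmod_morphism (fglift (f : T -> zmodule M)).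
Proof. exact: lift_is_additive. Qed.

Lemma fglift_gen t : fglift (f : T -> zmodule M) << t >> = f t.
Proof. by rewrite liftU scale1r. Qed.

Hypothesis fR : forall r, R r -> fglift (f : T -> zmodule M) r = 0.

Lemma pres_lift_gen t : pres_lift f (pres_gen R t) = f t.
Proof.
rewrite /pres_lift (repr_of_factor fglift_zm fR).
exact: fglift_gen.
Qed.

Lemma pres_liftB : zmod_morphism (pres_lift f : presented R -> M).
Proof. exact: (repr_of_factorB fglift_zm fR). Qed.

End Lift.
End Presented.

Section Tensor.
Variables (M N : zmodType).

Lemma tensB_l b : zmod_morphism (fun a : M => tens a b : tensor M N).
Proof.
apply: zmod_morphismD => a a'; apply/eqP; rewrite -subr_eq0 opprD addrA.
rewrite /tens /pres_gen -!class_ofB; apply/eqP/class_of_rel.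
exact: tens_addl.
Qed.

Lemma tensB_r a : zmod_morphism (fun b : N => tens a b : tensor M N).
Proof.
apply: zmod_morphismD => b b'; apply/eqP; rewrite -subr_eq0 opprD addrA.
rewrite /tens /pres_gen -!class_ofB; apply/eqP/class_of_rel.
exact: tens_addr.
Qed.

Lemma tens_ind (P : tensor M N -> Prop) :
  P 0 -> (forall a b, P a -> P b -> P (a - b)) ->
  (forall a b, P (tens a b)) -> forall x, P x.
Proof. by move=> P0 PB Pt; apply: pres_ind => // -[a b]; apply: Pt. Qed.

Lemma tens_eq (A : zmodType) (f g : tensor M N -> A) :
  zmod_morphism f -> zmod_morphism g ->
  (forall a b, f (tens a b) = g (tens a b)) -> f =1 g.
Proof. by move=> fB gB fg; apply: pres_eq => // -[a b]; apply: fg. Qed.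

Section Lift.
Variables (A : zmodType) (f : M * N -> A).
Hypothesis fl : forall b, zmod_morphism (fun a => f (a, b)).
Hypothesis fr : forall a, zmod_morphism (fun b => f (a, b)).

Let fR r : tens_rel r -> fglift (f : _ -> zmodule A) r = 0.
Proof.
case=> [a a' b|a b b']; rewrite !fglift_zm !fglift_gen.
  by rewrite (zmD (fl b)) addrAC addrK subrr.
by rewrite (zmD (fr a)) addrAC addrK subrr.
Qed.

Lemma tens_lift_gen a b : pres_lift f (tens a b) = f (a, b).
Proof. exact: (pres_lift_gen fR). Qed.

Lemma tens_liftB : zmod_morphism (pres_lift f : tensor M N -> A).
Proof. exact: (pres_liftB fR). Qed.

End Lift.
End Tensor.

Section TensorMap.
Variables (M N M' N' : zmodType) (f : M -> M') (g : N -> N').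
Hypotheses (fB : zmod_morphism f) (gB : zmod_morphism g).

Let fl b : zmod_morphism (fun a => tens (f a) (g b)).
Proof. by move=> a a'; rewrite fB tensB_l. Qed.
Let fr a : zmod_morphism (fun b => tens (f a) (g b)).
Proof. by move=> b b'; rewrite gB tensB_r. Qed.

Lemma tens_map_gen a b : tens_map f g (tens a b) = tens (f a) (g b).
Proof. exact: (@tens_lift_gen _ _ _ (fun ab => tens (f ab.1) (g ab.2))). Qed.

Lemma tens_mapB : zmod_morphism (tens_map f g).
Proof. exact: (@tens_liftB _ _ _ (fun ab => tens (f ab.1) (g ab.2))). Qed.

End TensorMap.

Lemma updE q (M : zmodType) (v : {ffun 'I_q -> M}) i a j :
  upd v i a j = if j == i then a else v j.
Proof. by rewrite ffunE. Qed.

Lemma upd_id q (M : zmodType) (v : {ffun 'I_q -> M}) i : upd v i (v i) = v.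
Proof. by apply/ffunP => j; rewrite !updE; case: eqP => // ->. Qed.

Lemma upd_comm q (M : zmodType) (v : {ffun 'I_q -> M}) i j a b : i != j ->
  upd (upd v i a) j b = upd (upd v j b) i a.
Proof.
move=> ij; apply/ffunP => k; rewrite !updE.
by have [->|//] := eqVneq k j; rewrite eq_sym (negPf ij).
Qed.

Section Exterior.
Variables (q : nat) (M : zmodType).
Implicit Types v : {ffun 'I_q -> M}.

Definition multiadditive (A : zmodType) (f : {ffun 'I_q -> M} -> A) :=
  forall v i, zmod_morphism (fun a => f (upd v i a)).

Definition alternating (A : zmodType) (f : {ffun 'I_q -> M} -> A) :=
  forall v i j, i != j -> v i = v j -> f v = 0.

Lemma wedge_upd : multiadditive (@wedge q M).
Proof.
move=> v i; apply: zmod_morphismD => a b; apply/eqP.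
rewrite -subr_eq0 opprD addrA /wedge /pres_gen -!class_ofB.
by apply/eqP/class_of_rel/ext_add.
Qed.

Lemma wedge_alt : alternating (@wedge q M).
Proof. by move=> v i j ij vij; apply/class_of_rel/(ext_alt ij). Qed.

Lemma ext_ind (P : ext q M -> Prop) :
  P 0 -> (forall a b, P a -> P b -> P (a - b)) ->
  (forall v, P (wedge v)) -> forall x, P x.
Proof. exact: pres_ind. Qed.

Lemma ext_eq (A : zmodType) (f g : ext q M -> A) :
  zmod_morphism f -> zmod_morphism g ->
  (forall v, f (wedge v) = g (wedge v)) -> f =1 g.
Proof. exact: pres_eq. Qed.

Section Lift.
Variables (A : zmodType) (f : {ffun 'I_q -> M} -> A).
Hypotheses (fB : multiadditive f) (fA : alternating f).

Let fR r : ext_rel r -> fglift (f : _ -> zmodule A) r = 0.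
Proof.
case=> [v i a b|v i j ij vij]; rewrite ?fglift_zm !fglift_gen.
  by rewrite (zmD (fB v i)) addrAC addrK subrr.
exact: fA vij.
Qed.

Lemma ext_lift_gen v : pres_lift f (wedge v) = f v.
Proof. exact: (pres_lift_gen fR). Qed.

Lemma ext_liftB : zmod_morphism (pres_lift f : ext q M -> A).
Proof. exact: (pres_liftB fR). Qed.

End Lift.
End Exterior.

(** * Exterior and interior multiplication *)

Section ExtMap.
Variable q : nat.

Section One.
Variables (M N : zmodType) (f : M -> N).
Hypothesis fB : zmod_morphism f.

Let map_upd (v : {ffun 'I_q -> M}) i a :
  [ffun j => f (upd v i a j)] = upd [ffun j => f (v j)] i (f a).
Proof. by apply/ffunP => j; rewrite !ffunE; case: (j == i). Qed.

Let fmulti : multiadditive (fun v : {ffun 'I_q -> M} => wedge [ffun i => f (v i)]).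
Proof. by move=> v i a b; rewrite !map_upd fB wedge_upd. Qed.

Let falt : alternating (fun v : {ffun 'I_q -> M} => wedge [ffun i => f (v i)]).
Proof. by move=> v i j ij vij; apply: (wedge_alt ij); rewrite !ffunE vij. Qed.

Lemma ext_map_gen (v : {ffun 'I_q -> M}) : ext_map f (wedge v) = wedge [ffun i => f (v i)].
Proof. exact: ext_lift_gen fmulti falt v. Qed.

Lemma ext_mapB : zmod_morphism (@ext_map q _ _ f).
Proof. exact: ext_liftB fmulti falt. Qed.

End One.

Lemma eq_ext_map (M N : zmodType) (f g : M -> N) :
  zmod_morphism f -> f =1 g -> @ext_map q _ _ f =1 ext_map g.
Proof.
move=> fB fg; have gB : zmod_morphism g by move=> a b; rewrite -!fg fB.
apply: ext_eq (ext_mapB fB) (ext_mapB gB) _ => v.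
by rewrite !ext_map_gen //; congr wedge; apply/ffunP => i; rewrite !ffunE fg.
Qed.

Lemma ext_map_comp (M N L : zmodType) (g : N -> L) (f : M -> N) :
  zmod_morphism g -> zmod_morphism f ->
  forall x : ext q M, ext_map g (ext_map f x) = ext_map (g \o f) x.
Proof.
move=> gB fB; apply: ext_eq => [||v].
- exact: zm_comp (ext_mapB gB) (ext_mapB fB).
- exact: ext_mapB (zm_comp gB fB).
rewrite !ext_map_gen //; last exact: zm_comp.
by congr wedge; apply/ffunP => i; rewrite !ffunE.
Qed.

Lemma ext_map_id (M : zmodType) (x : ext q M) : ext_map id x = x.
Proof.
move: x; apply: ext_eq => [||v] //; first exact: ext_mapB.
by rewrite ext_map_gen //; congr wedge; apply/ffunP => i; rewrite ffunE.
Qed.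

End ExtMap.

(** * Left multiplication by a vector *)

Section Cons.
Variable M : zmodType.

Definition vcons q (c : M) (v : {ffun 'I_q -> M}) : {ffun 'I_q.+1 -> M} :=
  [ffun i => oapp v c (unlift ord0 i)].

Lemma vcons0 q c (v : {ffun 'I_q -> M}) : vcons c v ord0 = c.
Proof. by rewrite ffunE unlift_none. Qed.

Lemma vconsS q c (v : {ffun 'I_q -> M}) i :
  vcons c v (fintype.lift ord0 i) = v i.
Proof. by rewrite ffunE liftK. Qed.

Lemma vcons_ext q (v w : {ffun 'I_q.+1 -> M}) :
  v ord0 = w ord0 ->
  (forall i, v (fintype.lift ord0 i) = w (fintype.lift ord0 i)) -> v = w.
Proof.
by move=> e0 eS; apply/ffunP => i; case: (unliftP ord0 i) => [j|] ->.
Qed.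

Lemma vcons_eta q (v : {ffun 'I_q.+1 -> M}) :
  v = vcons (v ord0) [ffun i => v (fintype.lift ord0 i)].
Proof. by apply: vcons_ext => [|i]; rewrite ?vcons0 ?vconsS ?ffunE. Qed.

Lemma upd_vcons0 q c (v : {ffun 'I_q -> M}) a :
  upd (vcons c v) ord0 a = vcons a v.
Proof.
by apply: vcons_ext => [|i]; rewrite updE ?vcons0 ?vconsS // eqxx.
Qed.

Lemma upd_vconsS q c (v : {ffun 'I_q -> M}) i a :
  upd (vcons c v) (fintype.lift ord0 i) a = vcons c (upd v i a).
Proof.
apply: vcons_ext => [|j]; rewrite updE ?vcons0 // !vconsS updE.
by rewrite (inj_eq lift_inj).
Qed.

Definition lwedge q (c : M) : ext q M -> ext q.+1 M :=
  pres_lift (fun v : {ffun 'I_q -> M} => wedge (vcons c v)).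

Section Lwedge.
Variable q : nat.

Let fmulti c : multiadditive (fun v : {ffun 'I_q -> M} => wedge (vcons c v)).
Proof. by move=> v i a b; rewrite -!upd_vconsS wedge_upd. Qed.

Let falt c : alternating (fun v : {ffun 'I_q -> M} => wedge (vcons c v)).
Proof.
move=> v i j ij vij; apply: (@wedge_alt _ _ _ (fintype.lift ord0 i) (fintype.lift ord0 j)).
  by rewrite (inj_eq lift_inj).
by rewrite !vconsS.
Qed.

Lemma lwedge_gen c (v : {ffun 'I_q -> M}) : lwedge c (wedge v) = wedge (vcons c v).
Proof. exact: ext_lift_gen (fmulti c) (falt c) v. Qed.

Lemma lwedgeB c : zmod_morphism (@lwedge q c).
Proof. exact: ext_liftB (fmulti c) (falt c). Qed.

Lemma lwedgeBl (u : ext q M) : zmod_morphism (fun c => lwedge c u).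
Proof.
move=> a b; move: u; apply: ext_eq => [||v].
- exact: lwedgeB.
- by apply: zm_sub; apply: lwedgeB.
rewrite !lwedge_gen -[vcons a v](upd_vcons0 a) -[vcons b v](upd_vcons0 a).
by rewrite -[vcons _ v](upd_vcons0 a) wedge_upd.
Qed.

(** The induction tool for exterior powers: products c /\ u generate degree q + 1, so identities
    reduce to the degree of u. *)
Lemma lwedge_eq (A : zmodType) (f g : ext q.+1 M -> A) :
  zmod_morphism f -> zmod_morphism g ->
  (forall c u, f (lwedge c u) = g (lwedge c u)) -> f =1 g.
Proof.
move=> fB gB fg; apply: ext_eq => // v.
by rewrite (vcons_eta v) -lwedge_gen.
Qed.

End Lwedge.

Lemma lwedge_sq q c (u : ext q M) : lwedge c (lwedge c u) = 0.
Proof.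
move: u; apply: (@ext_eq _ _ _ (@lwedge _ c \o @lwedge q c) (fun=> 0)) => [||v].
- exact: zm_comp (@lwedgeB _ c) (@lwedgeB _ c).
- by move=> a b; rewrite subrr.
rewrite /= !lwedge_gen; apply: (@wedge_alt _ _ _ ord0 (fintype.lift ord0 ord0)) => //.
by rewrite vconsS !vcons0.
Qed.

(** Polarization of the vanishing square at c + b. *)
Lemma lwedgeC q c b (u : ext q M) : lwedge c (lwedge b u) = - lwedge b (lwedge c u).
Proof.
have := lwedge_sq (c + b) u.
rewrite !(zmD (lwedgeBl _)) !(zmD (@lwedgeB _ _)) !lwedge_sq add0r addr0.
by move=> /eqP; rewrite addr_eq0 => /eqP.
Qed.

Lemma ext0_const (v w : {ffun 'I_0 -> M}) : v = w.
Proof. by apply/ffunP => -[]. Qed.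

End Cons.

Lemma ext_map_lwedge q (M N : zmodType) (f : M -> N) c (u : ext q M) :
  zmod_morphism f -> ext_map f (lwedge c u) = lwedge (f c) (ext_map f u).
Proof.
move=> fB; move: u; apply: ext_eq => [||v].
- exact: zm_comp (ext_mapB fB) (@lwedgeB _ _ c).
- exact: zm_comp (@lwedgeB _ _ _) (ext_mapB fB).
rewrite lwedge_gen !ext_map_gen // lwedge_gen; congr wedge.
by apply: vcons_ext => [|i]; rewrite ffunE ?vcons0 // !vconsS ffunE.
Qed.

Lemma ext_map0 (M : zmodType) (f : M -> M) : zmod_morphism f ->
  @ext_map 0 M M f =1 id.
Proof.
move=> fB; apply: ext_eq => [||v] //; first exact: ext_mapB.
by rewrite ext_map_gen //; congr wedge; exact: ext0_const.
Qed.

(** * The interior product as an antiderivation *)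

Section InteriorProduct.
Variables (M : zmodType).
Implicit Types (a b : M -> int).

Let ipf q a (v : {ffun 'I_q.+1 -> M}) : ext q M :=
  \sum_i wedge [ffun j => v (fintype.lift i j)] *~ ((-1) ^+ i * a (v i)).

Lemma vcons_lift q c (v : {ffun 'I_q.+1 -> M}) i :
  [ffun j => vcons c v (fintype.lift (fintype.lift ord0 i) j)]
  = vcons c [ffun j => v (fintype.lift i j)].
Proof.
apply: vcons_ext => [|j]; rewrite ffunE ?vcons0 ?vconsS ?ffunE.
  by rewrite (_ : fintype.lift _ _ = ord0) ?unlift_none //; apply: val_inj.
rewrite (_ : fintype.lift _ _ = fintype.lift ord0 (fintype.lift i j)) ?liftK //.
by apply: val_inj; rewrite /= /bump /= !add1n ltnS addnS.
Qed.

Lemma vcons_lift0 q c (v : {ffun 'I_q -> M}) :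
  [ffun j => vcons c v (fintype.lift ord0 j)] = v.
Proof. by apply/ffunP => j; rewrite ffunE vconsS. Qed.

Let ipf_cons0 a c (v : {ffun 'I_0 -> M}) :
  ipf a (vcons c v) = wedge v *~ a c.
Proof.
by rewrite /ipf big_ord_recl big_ord0 addr0 vcons0 vcons_lift0 mul1r.
Qed.

(** The antiderivation rule, on which the later inductions on the degree rest; the minus sign comes
    from shifting every index of v by one. *)
Let ipf_cons q a c (v : {ffun 'I_q.+1 -> M}) :
  ipf a (vcons c v) = wedge v *~ a c - lwedge c (ipf a v).
Proof.
rewrite /ipf big_ord_recl vcons0 vcons_lift0 mul1r; congr (_ + _).
rewrite (zm_sum (@lwedgeB _ _ c)) -sumrN; apply: eq_bigr => i _.
rewrite vconsS vcons_lift (zmMz (@lwedgeB _ _ c)) lwedge_gen -mulrNz.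
by rewrite lift0 exprS mulN1r mulNr.
Qed.

Let ipf_multi q a : zmod_morphism a -> multiadditive (@ipf q a).
Proof.
move=> aB; elim: q => [|q IH] v i x y; rewrite (vcons_eta v).
  by rewrite (ord1 i) !upd_vcons0 !ipf_cons0 aB mulrzBr.
case: (unliftP ord0 i) => [j|] ->; last first.
  by rewrite !upd_vcons0 !ipf_cons aB mulrzBr lwedgeBl subr_interchange.
by rewrite !upd_vconsS !ipf_cons wedge_upd IH lwedgeB mulrzBl subr_interchange.
Qed.

(* If v contains c, wedging with c kills all terms but the one omitting c. *)
Let lwedge_ipf q a c (v : {ffun 'I_q.+1 -> M}) j : v j = c ->
  lwedge c (ipf a v) = wedge v *~ a c.
Proof.
elim: q v j => [|q IH] v j; rewrite (vcons_eta v); set w := finfun _.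
  rewrite (ord1 j) vcons0 => ->.
  by rewrite ipf_cons0 (zmMz (@lwedgeB _ _ c)) lwedge_gen.
rewrite ipf_cons lwedgeB (zmMz (@lwedgeB _ _ _)) lwedge_gen.
case: (unliftP ord0 j) => [k|] ->; rewrite ?vcons0 ?vconsS => wc; last first.
  by rewrite wc lwedge_sq subr0.
rewrite lwedgeC (IH w k wc) (zmMz (@lwedgeB _ _ _)) lwedge_gen opprK.
rewrite (@wedge_alt _ _ (vcons c w) ord0 (fintype.lift ord0 k)) ?mul0rz ?add0r //.
by rewrite vcons0 vconsS.
Qed.

(** If both equal entries lie in the tail w, induction applies. If one of them is the head c, then c
    /\ iota(w) equals a(c) w and the two terms of the antiderivation rule cancel. *)
Let ipf_alt q a : alternating (@ipf q a).
Proof.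
elim: q => [|q IH] v i j; first by rewrite (ord1 i) (ord1 j) eqxx.
wlog ij : i j / (i < j)%N => [WL|].
  move=> ne vij; case: (ltngtP i j) => [lt|lt|/val_inj e]; last by rewrite e eqxx in ne.
    exact: (WL i j).
  by apply: (WL j i) => //; rewrite eq_sym.
move=> _; rewrite (vcons_eta v); set w := finfun _; rewrite ipf_cons.
case: (unliftP ord0 j) ij => [k|] -> // ij; case: (unliftP ord0 i) ij => [l|] -> ij.
  rewrite !vconsS => e; have lk : l != k by apply: contraTneq ij => ->; rewrite ltnn.
  by rewrite (wedge_alt lk e) (IH _ _ _ lk e) (zm0 (@lwedgeB _ _ _)) mul0rz subr0.
by rewrite vcons0 vconsS => e; rewrite (lwedge_ipf a (esym e)) subrr.
Qed.

Lemma iprodB q a : zmod_morphism a -> zmod_morphism (@iprod q M a).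
Proof. by move=> aB; apply: ext_liftB (ipf_multi aB) (@ipf_alt q a). Qed.

Let iprod_gen q a v : zmod_morphism a -> iprod a (wedge v) = @ipf q a v.
Proof. by move=> aB; apply: (ext_lift_gen (ipf_multi aB) (@ipf_alt q a)). Qed.

Lemma iprod_lwedge0 a c (u : ext 0 M) : zmod_morphism a ->
  iprod a (lwedge c u) = u *~ a c.
Proof.
move=> aB; move: u; apply: ext_eq => [||v].
- exact: zm_comp (iprodB aB) (@lwedgeB _ _ c).
- exact: zm_mulz.
by rewrite lwedge_gen iprod_gen // ipf_cons0.
Qed.

Lemma iprod_lwedge q a c (u : ext q.+1 M) : zmod_morphism a ->
  iprod a (lwedge c u) = u *~ a c - lwedge c (iprod a u).
Proof.
move=> aB; move: u; apply: ext_eq => [||v].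
- exact: zm_comp (iprodB aB) (@lwedgeB _ _ c).
- by apply: zm_sub; [exact: zm_mulz|exact: zm_comp (@lwedgeB _ _ _) (iprodB aB)].
by rewrite lwedge_gen !iprod_gen // ipf_cons.
Qed.

(** Applying the antiderivation rule twice produces a(c) iota(u) with opposite signs, plus a term
    that vanishes by induction. *)
Lemma iprod_sq q a (u : ext q.+2 M) : zmod_morphism a -> iprod a (iprod a u) = 0.
Proof.
move=> aB; elim: q u => [|q IH];
  apply: (@lwedge_eq _ _ _ (@iprod _ M a \o @iprod _ M a) (fun=> 0)).
- exact: zm_comp (iprodB aB) (iprodB aB).
- by move=> ? ?; rewrite subrr.
- move=> c u /=; rewrite iprod_lwedge // (iprodB aB) (zmMz (iprodB aB)).
  by rewrite iprod_lwedge0 // subrr.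
- exact: zm_comp (iprodB aB) (iprodB aB).
- by move=> ? ?; rewrite subrr.
move=> c u /=; rewrite iprod_lwedge // (iprodB aB) (zmMz (iprodB aB)).
by rewrite iprod_lwedge // IH (zm0 (@lwedgeB _ _ c)) subr0 subrr.
Qed.

Lemma iprodDl q a b (u : ext q.+1 M) : zmod_morphism a -> zmod_morphism b ->
  iprod (fun z => a z + b z) u = iprod a u + iprod b u.
Proof.
move=> aB bB.
have abB : zmod_morphism (fun z => a z + b z).
  exact: zm_add.
move: u; apply: ext_eq => [||v]; first exact: iprodB.
  by apply: zm_add; apply: iprodB.
rewrite !iprod_gen // -big_split; apply: eq_bigr => i _ /=.
by rewrite mulrDr mulrzDr.
Qed.

(** Polarization of the vanishing square of contraction, at a + b. *)
Lemma iprodC q a b (u : ext q.+2 M) : zmod_morphism a -> zmod_morphism b ->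
  iprod a (iprod b u) + iprod b (iprod a u) = 0.
Proof.
move=> aB bB.
have abB : zmod_morphism (fun z => a z + b z).
  exact: zm_add.
have := iprod_sq u abB; rewrite !iprodDl // !(zmD (iprodB aB)) !(zmD (iprodB bB)).
by rewrite !iprod_sq // addr0 add0r addrC.
Qed.

(* The projection z - a z c along c acts on exterior powers as 1 - c /\ iota_a. *)
Lemma ext_map_proj q a c (u : ext q.+1 M) : zmod_morphism a ->
  ext_map (fun z => z - c *~ a z) u = u - lwedge c (iprod a u).
Proof.
move=> aB; set pr := fun z => _.
have prB : zmod_morphism pr.
  by apply: zm_sub => //; apply: zm_mulzr.
have RB n : zmod_morphism (fun u : ext n.+1 M => u - lwedge c (iprod a u)).
  by apply: zm_sub => //; apply: zm_comp (@lwedgeB _ _ _) (iprodB aB).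
elim: q u => [|q IH]; apply: lwedge_eq => //; try exact: ext_mapB; move=> b u.
  rewrite ext_map_lwedge // ext_map0 // iprod_lwedge0 // lwedgeBl.
  by rewrite (zmMz (lwedgeBl _)) (zmMz (@lwedgeB _ _ _)).
rewrite ext_map_lwedge // IH iprod_lwedge // !lwedgeB !lwedgeBl.
rewrite (zmMz (lwedgeBl _)) (zmMz (@lwedgeB _ _ _)) (zmMz (lwedgeBl (lwedge _ _))).
by rewrite lwedge_sq mul0rz subr0 (lwedgeC b c) opprK opprB [in RHS]addrA addrAC.
Qed.

(** Since contraction by a squares to zero, the correction term of [ext_map_proj] disappears. When
    a(c) = 1 the map is the projection onto ker a, so contractions by a come from the exterior power
    of ker a. *)
Lemma ext_map_proj_iprod q a c (u : ext q.+1 M) : zmod_morphism a ->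
  ext_map (fun z => z - c *~ a z) (iprod a u) = iprod a u.
Proof.
case: q u => [|q] u aB; last first.
  by rewrite ext_map_proj // iprod_sq // (zm0 (@lwedgeB _ _ _)) subr0.
by rewrite ext_map0 //; apply: zm_sub => //; apply: zm_mulzr.
Qed.

End InteriorProduct.

(** Naturality of contraction: both sides satisfy the same antiderivation rule, so induction on the
    degree applies. *)
Lemma iprod_ext_map q (M N : zmodType) (f : M -> N) (a : N -> int) (u : ext q.+1 M) :
  zmod_morphism f -> zmod_morphism a ->
  iprod a (ext_map f u) = ext_map f (iprod (a \o f) u).
Proof.
move=> fB aB; have afB := zm_comp aB fB.
have LB n := zm_comp (@iprodB _ n _ aB) (ext_mapB fB).
have RB n := zm_comp (ext_mapB fB) (@iprodB _ n _ afB).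
elim: q u => [|q IH].
  apply: (lwedge_eq (LB _) (RB _)) => c u /=.
  by rewrite ext_map_lwedge // !iprod_lwedge0 // (zmMz (ext_mapB fB)).
apply: (lwedge_eq (LB _) (RB _)) => c u /=.
rewrite ext_map_lwedge // !iprod_lwedge // (ext_mapB fB) (zmMz (ext_mapB fB)).
by rewrite ext_map_lwedge // IH.
Qed.

(** * Permuting the factors of a wedge *)

Section WedgePerm.
Variables (q : nat) (M : zmodType).
Implicit Types v : {ffun 'I_q -> M}.

(** With v_i + v_j in both slots the wedge is zero; expanding leaves the two orders, which therefore
    add up to zero. *)
Lemma wedge_tperm v i j : i != j ->
  wedge [ffun k => v (tperm i j k)] = - wedge v.
Proof.
move=> ij; pose u a b := upd (upd v i a) j b.
have uDr a b b' : wedge (u a (b + b')) = wedge (u a b) + wedge (u a b').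
  by rewrite /u (zmD (wedge_upd _ _)).
have uDl a a' b : wedge (u (a + a') b) = wedge (u a b) + wedge (u a' b).
  by rewrite /u !(upd_comm _ _ _ ij) (zmD (wedge_upd _ _)).
have u0 a : wedge (u a a) = 0.
  by apply: (wedge_alt ij); rewrite !updE eqxx (negPf ij) eqxx.
have := u0 (v i + v j); rewrite uDr !uDl !u0 addr0 add0r => /eqP.
rewrite addr_eq0 => /eqP e.
rewrite (_ : finfun _ = u (v j) (v i)); last first.
  apply/ffunP => k; rewrite ffunE !updE; case: tpermP => [->|->|/eqP/negPf nei /eqP/negPf nej].
  - by rewrite (negPf ij) eqxx.
  - by rewrite eqxx.
  - by rewrite nei nej.
rewrite (_ : wedge v = wedge (u (v i) (v j))).
  by rewrite e.
congr wedge; apply/ffunP => k; rewrite !updE.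
by case: eqP => [->//|_]; case: eqP => [->|].
Qed.

(** The sign is left undetermined because the result serves to prove membership in a span, which is
    closed under negation. *)
Lemma wedge_perm v (s : 'S_q) :
  wedge [ffun k => v (s k)] = wedge v \/ wedge [ffun k => v (s k)] = - wedge v.
Proof.
case: (prod_tpermP s) => ts -> {s}; elim: ts v => [|[i j] ts IH] v /=.
  move=> _; left; rewrite big_nil; congr wedge.
  by apply/ffunP => k; rewrite ffunE perm1.
case/andP=> ij /IH => /(_ v) {}IH; rewrite big_cons /=.
pose w := [ffun k => v ((\prod_(t <- ts) tperm t.1 t.2)%g k)].
rewrite (_ : finfun _ = [ffun k => w (tperm i j k)]).
  by rewrite wedge_tperm //; case: IH => ->; [right|left; rewrite opprK].
by apply/ffunP => k; rewrite !ffunE permM.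
Qed.
End WedgePerm.

(** * Rank of tensor products, exterior powers and direct sums *)

Definition torsion (M : zmodType) (a : M) : Prop :=
  exists2 m : int, m != 0 & a *~ m = 0.

Lemma clear_denominators (I : finType) (r : I -> rat) :
  exists m : int, exists2 c : I -> int,
    m != 0 & forall i, r i * m%:~R = (c i)%:~R.
Proof.
exists (\prod_i denq (r i)), (fun i => numq (r i) * \prod_(j | j != i) denq (r j)).
  by apply/prodf_neq0 => i _; rewrite denq_neq0.
move=> i; rewrite (bigD1 i) //= !intrM mulrA; congr (_ * _).
by rewrite -{1}(divq_num_den (r i)) divfK // intr_eq0 denq_neq0.
Qed.

Section RationalSpan.
Variables (M : zmodType) (I : finType) (x : I -> M).

(** Membership in the rational span of x, phrased without tensoring with Q: torsion elements belong
    to it automatically. *)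
Definition qspan (a : M) : Prop :=
  exists m : int, exists2 c : I -> int, m != 0 & a *~ m = \sum_i x i *~ c i.

Lemma qspan0 : qspan 0.
Proof.
by exists 1, (fun=> 0) => //; rewrite mul0rz big1 // => i _; rewrite mulr0z.
Qed.

Lemma qspanB a b : qspan a -> qspan b -> qspan (a - b).
Proof.
move=> [m [c m0 ea]] [k [d k0 eb]]; exists (m * k), (fun i => c i * k - d i * m).
  by rewrite mulf_neq0.
rewrite mulrzBl mulrzA ea [m * k]mulrC mulrzA eb !mulrz_suml -sumrB.
by apply: eq_bigr => i _; rewrite -!mulrzA -mulrzBr.
Qed.

Lemma qspanN a : qspan a -> qspan (- a).
Proof. by move=> xa; rewrite -sub0r; apply: qspanB => //; apply: qspan0. Qed.

Lemma qspanD a b : qspan a -> qspan b -> qspan (a + b).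
Proof. by move=> xa xb; rewrite -[b]opprK; apply/qspanB/qspanN. Qed.

Lemma qspanZ a n : qspan a -> qspan (a *~ n).
Proof.
move=> [m [c m0 ea]]; exists m, (fun i => c i * n) => //.
rewrite -mulrzA [n * m]mulrC mulrzA ea mulrz_suml.
by apply: eq_bigr => i _; rewrite mulrzA.
Qed.

Lemma qspan_sum (J : Type) (r : seq J) (P : pred J) (F : J -> M) :
  (forall j, P j -> qspan (F j)) -> qspan (\sum_(j <- r | P j) F j).
Proof. by move=> PF; apply: big_ind => //; [exact: qspan0|exact: qspanD]. Qed.

Lemma qspan_sat a m : m != 0 -> qspan (a *~ m) -> qspan a.
Proof.
move=> m0 [k [c k0 e]]; exists (m * k), c; first by rewrite mulf_neq0.
by rewrite mulrzA.
Qed.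

Lemma qspan_gen i : qspan (x i).
Proof.
exists 1, (fun j => (j == i)%:R) => //.
rewrite (bigD1 i) //= eqxx big1 ?addr0 // => j /negPf ->.
by rewrite mulr0z.
Qed.

End RationalSpan.

(* x is a basis of the rational vector space M (x) Q, with dual coordinates phi. *)
Definition qframe (M : zmodType) (I : finType) (phi : M -> I -> rat) (x : I -> M) :=
  [/\ forall i, zmod_morphism (phi^~ i),
      forall i j, phi (x i) j = (i == j)%:R &
      forall a, (forall i, phi a i = 0) -> torsion a].

Section Frames.
Variables (M : zmodType) (I : finType) (phi : M -> I -> rat) (x : I -> M).
Hypotheses (phiB : forall i, zmod_morphism (phi^~ i))
           (phix : forall i j, phi (x i) j = (i == j)%:R).

Lemma frame_coord (c : I -> int) j : phi (\sum_i x i *~ c i) j = (c j)%:~R.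
Proof.
rewrite (zm_sum (phiB j)) (bigD1 j) //= big1 ?addr0 => [|i ij].
  by rewrite (zmMz (phiB j)) phix eqxx.
by rewrite (zmMz (phiB j)) phix (negPf ij) mul0rz.
Qed.

(** Given dual coordinates, spanning already yields the torsion clause: the coefficients of a
    multiple of a are the coordinates of that multiple, all zero. *)
Lemma frame_of_span : (forall a, qspan x a) -> qframe phi x.
Proof.
move=> xs; split=> // a a0; have [m [c m0 e]] := xs a; exists m => //.
rewrite e big1 // => i _; have := frame_coord c i; rewrite -e (zmMz (phiB i)) a0.
by rewrite mul0rz => /esym/eqP; rewrite intr_eq0 => /eqP ->; rewrite mulr0z.
Qed.

(** After clearing the denominators of the coordinates of a, the multiple of a and the matching
    integral combination have the same coordinates, hence differ by torsion. *)
Lemma frame_span : (forall a, (forall i, phi a i = 0) -> torsion a) ->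
  forall a, qspan x a.
Proof.
move=> tf a; have [m [c m0 e]] := clear_denominators (phi a).
have [|k k0 ek] := tf (a *~ m - \sum_i x i *~ c i).
  by move=> i; rewrite phiB frame_coord (zmMz (phiB i)) -mulrzr e subrr.
apply: (qspan_sat m0); exists k, (fun i => c i * k) => //.
apply/eqP; rewrite -subr_eq0 -[X in _ == X]ek mulrzBl mulrz_suml; apply/eqP.
by congr (_ - _); apply: eq_bigr => i _; rewrite mulrzA.
Qed.

End Frames.

Definition has_rank (M : zmodType) (n : nat) : Prop :=
  exists phi, exists x, @qframe M 'I_n phi x.

Lemma frame_rank (M : zmodType) (I : finType) phi x :
  @qframe M I phi x -> has_rank M #|I|.
Proof.
case=> phiB phix phiT.
exists (fun a i => phi a (enum_val i)), (fun i => x (enum_val i)); split.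
- by move=> i; apply: phiB.
- by move=> i j; rewrite phix (inj_eq enum_val_inj).
by move=> a a0; apply: phiT => i; rewrite -[i]enum_rankK.
Qed.

Section TensorRank.
Variables (M N : zmodType) (I J : finType).
Variables (phi : M -> I -> rat) (x : I -> M) (psi : N -> J -> rat) (y : J -> N).
Hypotheses (Mf : qframe phi x) (Nf : qframe psi y).

(** The dual coordinates are the products of a coordinate on M and one on N, which are biadditive
    and so descend to the tensor product. *)
Lemma tensor_frame : exists chi : tensor M N -> (I * J)%type -> rat,
  qframe chi (fun ij => tens (x ij.1) (y ij.2)).
Proof.
case: Mf Nf => [phiB phix phiT] [psiB psiy psiT].
pose f (ij : I * J) (ab : M * N) := phi ab.1 ij.1 * psi ab.2 ij.2.
have fl ij b : zmod_morphism (fun a => f ij (a, b)).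
  by move=> a a'; rewrite /f /= phiB mulrBl.
have fr ij a : zmod_morphism (fun b => f ij (a, b)).
  by move=> b b'; rewrite /f /= psiB mulrBr.
exists (fun u ij => pres_lift (f ij) u); apply: frame_of_span.
- by move=> ij; apply: tens_liftB.
- move=> [i j] [i' j']; rewrite (tens_lift_gen (fl _) (fr _)) /f /= phix psiy.
  by rewrite -natrM mulnb.
apply: tens_ind => [|a b|a b]; [exact: qspan0|exact: qspanB|].
have [m [c m0 ea]] := frame_span phiB phix phiT a.
have [k [d k0 eb]] := frame_span psiB psiy psiT b.
apply: (qspan_sat m0); rewrite -(zmMz (@tensB_l _ _ b)) ea (zm_sum (@tensB_l _ _ b)).
apply: qspan_sum => i _; rewrite (zmMz (@tensB_l _ _ b)); apply: qspanZ.
apply: (qspan_sat k0); rewrite -(zmMz (@tensB_r _ _ _)) eb (zm_sum (@tensB_r _ _ _)).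
apply: qspan_sum => j _; rewrite (zmMz (@tensB_r _ _ _)); apply: qspanZ.
exact: (qspan_gen (fun ij => tens (x ij.1) (y ij.2)) (i, j)).
Qed.

End TensorRank.

Lemma tensor_rank (M N : zmodType) m n :
  has_rank M m -> has_rank N n -> has_rank (tensor M N) (m * n).
Proof.
move=> [phi [x Mf]] [psi [y Nf]]; have [chi /frame_rank] := tensor_frame Mf Nf.
by rewrite card_prod !card_ord.
Qed.

Section ExtRank.
Variables (q n : nat) (M : zmodType) (phi : M -> 'I_n -> rat) (x : 'I_n -> M).
Hypothesis Mf : qframe phi x.

(** Slots of a wedge are turned into frame elements one at a time, those below k being still
    untreated; closure under division by nonzero integers absorbs the denominators. *)
Let wspan (P : ext q M -> Prop) :
  P 0 -> (forall a b, P a -> P b -> P (a - b)) ->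
  (forall a m, m != 0 -> P (a *~ m) -> P a) ->
  (forall f : 'I_q -> 'I_n, P (wedge [ffun i => x (f i)])) -> forall a, P a.
Proof.
case: Mf => phiB phix phiT P0 PB Psat Pf; apply: ext_ind => // v.
have PN b : P b -> P (- b) by move=> Pb; rewrite -sub0r; apply: PB.
have PD b c : P b -> P c -> P (b + c).
  by move=> Pb Pc; rewrite -[c]opprK; apply: PB => //; apply: PN.
have PZ b k : P b -> P (b *~ k).
  move=> Pb; elim/int_ind: k => [|k IH|k IH]; first by rewrite mulr0z.
    by rewrite intS mulrzDr; apply: (PD).
  by rewrite intS opprD mulrzDr; apply: (PD) => //; rewrite mulrN1z; apply: PN.
suff H k : (k <= q)%N ->
    (forall i : 'I_q, (k <= i)%N -> exists j, v i = x j) -> P (wedge v).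
  by apply: (H q) => // i; rewrite leqNgt ltn_ord.
elim: k v => [|k IH] v kq xv.
  have [f xf] : exists f : 'I_q -> 'I_n, forall i, v i = x (f i).
    by apply: (@fin_all_exists _ _ (fun i j => v i = x j)) => i; apply: xv.
  by rewrite (_ : v = [ffun i => x (f i)]) //; apply/ffunP => i; rewrite ffunE xf.
pose i := Ordinal kq; rewrite -[v](upd_id _ i).
have [m [c m0 e]] := frame_span phiB phix phiT (v i).
apply: (Psat _ m) => //; rewrite -(zmMz (wedge_upd v i)) e (zm_sum (wedge_upd v i)).
apply: big_ind => // j _; rewrite (zmMz (wedge_upd v i)); apply: PZ.
apply: IH => [|l kl]; first exact: ltnW.
rewrite updE; case: eqP => [_|li]; first by exists j.
apply: xv; rewrite ltn_neqAle kl andbT; apply: contra_notN li => /eqP kl'.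
exact/val_inj.
Qed.

Let K := {A : {set 'I_n} | #|A| == q}.

Let e (A : K) (i : 'I_q) : 'I_n :=
  enum_val (cast_ord (esym (eqP (valP A))) i).

Let e_inj A : injective (e A).
Proof. by move=> i j /enum_val_inj/cast_ord_inj. Qed.

Let e_in A i : e A i \in val A.
Proof. exact: enum_valP. Qed.

Let e_onto (A : K) a : a \in val A -> exists i, e A i = a.
Proof.
move=> aA; exists (cast_ord (eqP (valP A)) (enum_rank_in aA a)).
by rewrite /e cast_ordK enum_rankK_in.
Qed.

(** Pluecker coordinates: the A-coordinate of a wedge is the q by q minor of its coordinate matrix
    on the columns in A. *)
Lemma ext_frame : exists chi : ext q M -> K -> rat,
  qframe chi (fun A => wedge [ffun i => x (e A i)]).
Proof.
case: (Mf) => phiB phix phiT.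
pose mx (A : K) (v : {ffun 'I_q -> M}) := \matrix_(i, j) phi (v i) (e A j).
have fm A : multiadditive (fun v => \det (mx A v)).
  move=> v i a b; rewrite (@determinant_multilinear _ _ _ (mx A (upd v i a))
    (mx A (upd v i b)) i 1 (-1)) ?mul1r ?mulN1r //.
  - by apply/rowP => j; rewrite !mxE !updE eqxx phiB mul1r mulN1r.
  - by apply/matrixP => k l; rewrite !mxE !updE eq_sym (negPf (neq_lift _ _)).
  - by apply/matrixP => k l; rewrite !mxE !updE eq_sym (negPf (neq_lift _ _)).
have fa A : alternating (fun v => \det (mx A v)).
  by move=> v i j ij vij; apply: (determinant_alternate ij) => k; rewrite !mxE vij.
exists (fun u A => pres_lift (fun v => \det (mx A v)) u).
apply: frame_of_span.
- by move=> A; apply: (ext_liftB (fm A) (fa A)).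
- move=> A B; rewrite (ext_lift_gen (fm B) (fa B)).
  have [<-|AB] := eqVneq A B.
    rewrite (_ : mx _ _ = 1%:M) ?det1 //; apply/matrixP => i j.
    by rewrite !mxE ffunE phix (inj_eq (@e_inj A)).
  (* Distinct sets of equal size: some a in A is missing from B, and its row in the minor is
     zero. *)
  have /subsetPn[a aA aB] : ~~ (val A \subset val B).
    apply: contra AB => AB; rewrite -val_eqE eqEcard AB.
    by rewrite (eqP (valP A)) (eqP (valP B)) leqnn.
  have [i ei] := e_onto aA.
  rewrite (expand_det_row _ i) big1 // => j _; rewrite !mxE ffunE phix ei.
  case: eqP => [ea|_]; last by rewrite mul0r.
  by rewrite ea e_in in aB.
apply: wspan => [|a b|a m|f]; [exact: qspan0|exact: qspanB|exact: qspan_sat|].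
have [/injectiveP fi|/injectivePn[i [j ij fij]]] := boolP (injectiveb f); last first.
  by rewrite (@wedge_alt _ _ _ i j ij) ?ffunE ?fij //; apply: qspan0.
have cA : #|f @: [set: 'I_q]| == q by rewrite card_imset // cardsT card_ord.
pose A : K := exist (fun A : {set 'I_n} => #|A| == q) _ cA.
have [s es] : exists s : 'I_q -> 'I_q, forall i, e A (s i) = f i.
  apply: (@fin_all_exists _ _ (fun i j => e A j = f i)) => i; apply: e_onto.
  exact: imset_f.
have si : injective s by move=> i j sij; apply: fi; rewrite -!es sij.
(* An injective family of indices is a permutation of the enumeration of its image. *)
have -> : [ffun i => x (f i)] =
    [ffun i => [ffun i => x (e A i)] (perm si i)].
  by apply/ffunP => i; rewrite !ffunE permE es.
have xA := qspan_gen (fun A => wedge [ffun i => x (e A i)]) A.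
case: (wedge_perm [ffun i => x (e A i)] (perm si)) => ->; first exact: xA.
exact: qspanN.
Qed.

End ExtRank.

Lemma ext_rank (M : zmodType) n q : has_rank M n -> has_rank (ext q M) 'C(n, q).
Proof.
move=> [phi [x Mf]]; have [chi /frame_rank] := ext_frame q Mf.
rewrite card_sig (_ : #|_| = #|[set A : {set 'I_n} | #|A| == q]|).
  by rewrite card_draws card_ord.
by apply: eq_card => A; rewrite !inE.
Qed.

Section DsumRank.
Variables (I : finType) (M : I -> zmodType).

Lemma dsum_projB i : zmod_morphism (fun u : dsum M => u i).
Proof. by move=> u v; rewrite /= !ffunE. Qed.

Lemma dsum_rank (n : I -> nat) : (forall i, has_rank (M i) (n i)) ->
  has_rank (dsum M) (\sum_i n i).
Proof.
move=> Mr.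
have /(@fin_all_exists _ (fun i => M i -> 'I_(n i) -> rat)) := Mr.
move=> [phi] /(@fin_all_exists _ (fun i => 'I_(n i) -> M i)) [x Mf].
pose K := {i : I & 'I_(n i)}.
pose chi (u : dsum M) (k : K) := phi (tag k) (u (tag k)) (tagged k).
pose y (k : K) : dsum M := [ffun i => dfwith (fun i => 0 : M i) (x (tag k) (tagged k)) i].
have /frame_rank : qframe chi y.
  split.
  - by move=> [i j] u v; rewrite /chi /= dsum_projB; case: (Mf i) => + _ _; apply.
  - move=> [i j] [i' j']; rewrite /chi /y /= ffunE; case: (eqVneq i i') j' => [<-|ii'] j'.
      rewrite dfwith_in; case: (Mf i) => _ -> _.
      by rewrite eq_Tagged /=.
    rewrite dfwith_out //; case: (Mf i') => fB _ _; rewrite (zm0 (fB _)).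
    by rewrite -tag_eqE /tag_eq /= (negPf ii').
  move=> u u0.
  have /(@fin_all_exists _ (fun=> int)) [m um] i : exists m, m != 0 /\ u i *~ m = 0.
    case: (Mf i) => _ _ /(_ (u i)) [|m m0 e]; last by exists m.
    by move=> j; apply: (u0 (existT _ i j : K)).
  exists (\prod_i m i); first by apply/prodf_neq0 => i _; case: (um i).
  apply/ffunP => i; rewrite [LHS](zmMz (dsum_projB i)) ffunE (bigD1 i) //= mulrzA.
  by case: (um i) => _ ->; rewrite mul0rz.
rewrite card_tagged sumnE big_map big_enum.
by under eq_bigr do rewrite card_ord.
Qed.

End DsumRank.

(** * Rank of cohomology *)

Lemma is_zrank_zrank (M : zmodType) (P : M -> Prop) n : is_zrank P n -> zrank P = n.
Proof.
move=> Pn; have [[x [Px xi]] ub] : is_zrank P (zrank P).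
  exact: (classical_sets.xgetI 0%N Pn).
have [[y [Py yi]] ub'] := Pn.
by apply/anti_leq/andP; split; [exact: ub' xi|exact: ub yi].
Qed.

Lemma clear_row n (u : 'rV[rat]_n) : exists m : int, exists2 c : 'I_n -> int,
  m != 0 & m%:~R *: u = \row_i (c i)%:~R.
Proof.
have [m [c m0 e]] := clear_denominators (u 0); exists m, c => //.
by apply/rowP => i; rewrite !mxE mulrC e.
Qed.

(** * Ranks as dimensions of rational row spaces *)

Section ImageRank.
Variables (M : zmodType) (n : nat) (f : M -> 'rV[rat]_n).
Hypotheses (fB : zmod_morphism f) (fT : forall a, f a = 0 -> torsion a).

Lemma image_coord s (y : 'I_s -> M) (c : 'I_s -> int) :
  f (\sum_i y i *~ c i) = (\row_i (c i)%:~R) *m \matrix_i f (y i).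
Proof.
apply/rowP => j.
have gB : zmod_morphism (fun a => f a 0 j) by move=> a b; rewrite fB !mxE.
rewrite [LHS](zm_sum gB) mxE; apply: eq_bigr => i _.
by rewrite (zmMz gB) !mxE mulrzl.
Qed.

(** A rational relation between the images, once denominators are cleared, gives an integral
    combination that is torsion; a further multiple is an integral relation, excluded by
    independence. *)
Lemma indep_row_free s (y : 'I_s -> M) : indep y -> row_free (\matrix_i f (y i)).
Proof.
move=> yi; rewrite -kermx_eq0; apply/eqP/row_matrixP => j; rewrite row0.
set u := row j _; have uY : u *m \matrix_i f (y i) = 0.
  by apply/sub_kermxP; apply: row_sub.
have [m [c m0 e]] := clear_row u.
have [|k k0 ek] := fT (a := \sum_i y i *~ c i).
  by rewrite image_coord -e -scalemxAl uY scaler0.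
have {}ek : \sum_i y i *~ (c i * k) = 0.
  by rewrite -[RHS]ek mulrz_suml; apply: eq_bigr => i _; rewrite mulrzA.
have c0 i : c i = 0.
  by have /eqP := yi _ ek i; rewrite mulf_eq0 (negPf k0) orbF => /eqP.
have : m%:~R *: u = 0 by rewrite e; apply/rowP => i; rewrite !mxE c0.
by move/eqP; rewrite scaler_eq0 intr_eq0 (negPf m0) => /eqP.
Qed.

(** W is the rational span of the image of P. Its vectors need only be reached up to a nonzero
    integer factor, which does not affect dimensions. *)
Lemma zrank_image (P : M -> Prop) k (W : 'M[rat]_(k, n)) :
  (forall a, P a -> (f a <= W)%MS) ->
  (forall v, (v <= W)%MS ->
     exists m : int, exists2 a, m != 0 /\ P a & f a = m%:~R *: v) ->
  zrank P = \rank W.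
Proof.
move=> PW WP; apply: is_zrank_zrank; split.
  have /(@fin_all_exists _ (fun=> int)) [m] : forall i : 'I_(\rank W),
      exists m : int, exists2 a, m != 0 /\ P a & f a = m%:~R *: row i (row_base W).
    by move=> i; apply: WP; rewrite -(eq_row_base W) row_sub.
  move=> /fin_all_exists2 [x mP fx].
  exists x; split=> [i|c c0 i]; first by case: (mP i).
  have : (\row_i (c i * m i)%:~R) *m row_base W = 0 :> 'rV[rat]_n.
    have := image_coord x c; rewrite c0 (zm0 fB) => /esym <-.
    rewrite !mulmx_sum_row; apply: eq_bigr => j _.
    by rewrite !mxE rowK fx scalerA intrM.
  move/eqP; rewrite -(mul0mx _ (row_base W)) (inj_eq (row_free_inj (row_base_free W))).
  move=> /eqP/rowP/(_ i); rewrite !mxE => /eqP; rewrite intr_eq0 mulf_eq0.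
  by case: (mP i) => /negPf -> _; rewrite orbF => /eqP.
move=> s y Py yi; have /eqP <- := indep_row_free yi.
by apply/mxrankS/row_subP => i; rewrite rowK; apply: PW.
Qed.

(** A basis of W lifts to M up to nonzero integers. The lifts form the frame, and a right inverse of
    the matrix of their images gives the dual coordinates. *)
Lemma has_rank_image k (W : 'M[rat]_(k, n)) :
  (forall a, (f a <= W)%MS) ->
  (forall v, (v <= W)%MS ->
     exists m : int, exists2 a, m != 0 & f a = m%:~R *: v) ->
  has_rank M (\rank W).
Proof.
move=> MW WM.
have /(@fin_all_exists _ (fun=> int)) [m] : forall i : 'I_(\rank W),
    exists m : int, exists2 a, m != 0 & f a = m%:~R *: row i (row_base W).
  by move=> i; apply: WM; rewrite -(eq_row_base W) row_sub.
move=> /fin_all_exists2 [x m0 fx].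
pose X := \matrix_i f (x i).
have Xf : row_free X.
  rewrite -kermx_eq0; apply/eqP/row_matrixP => j; rewrite row0.
  set u := row j _; have uY : u *m X = 0.
    by apply/sub_kermxP; apply: row_sub.
  have : (\row_i (u 0 i * (m i)%:~R)) *m row_base W = 0.
    rewrite -uY !mulmx_sum_row; apply: eq_bigr => i _.
    by rewrite mxE rowK fx scalerA.
  move/eqP; rewrite -(mul0mx _ (row_base W)) (inj_eq (row_free_inj (row_base_free W))).
  move=> /eqP/rowP e; apply/rowP => i; have := e i; rewrite !mxE => /eqP.
  by rewrite mulf_eq0 intr_eq0 (negPf (m0 i)) orbF => /eqP.
have XW : (X :=: W)%MS.
  apply/eqmxP; rewrite -mxrank_leqif_eq ?(eqP Xf) //.
  by apply/row_subP => i; rewrite rowK; apply: MW.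
exists (fun a i => (f a *m pinvmx X) 0 i), x; split.
- by move=> i a b /=; rewrite fB mulmxBl !mxE.
- by move=> i j; rewrite -(rowK (fun i => f (x i))) -row_mul mulmxVp // !mxE.
- move=> a a0; apply: fT; rewrite -(@mulmxKpV _ _ _ _ (f a) X) ?XW //.
  by rewrite (_ : f a *m _ = 0) ?mul0mx //; apply/rowP => i; rewrite a0 mxE.
Qed.

End ImageRank.

Definition coords (M : zmodType) n (phi : M -> 'I_n -> rat) (a : M) : 'rV[rat]_n :=
  \row_i phi a i.

Section Coords.
Variables (M : zmodType) (n : nat) (phi : M -> 'I_n -> rat) (x : 'I_n -> M).
Hypothesis Mf : qframe phi x.

Lemma coordsB : zmod_morphism (coords phi).
Proof. by case: Mf => fB _ _ a b; apply/rowP => i; rewrite !mxE fB. Qed.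

Lemma coords_torsion a : coords phi a = 0 -> torsion a.
Proof.
by case: Mf => _ _ fT /rowP e; apply: fT => i; have := e i; rewrite !mxE.
Qed.

Lemma coords_onto (v : 'rV[rat]_n) : exists m : int, exists2 a,
  m != 0 & coords phi a = m%:~R *: v.
Proof.
have [m [c m0 e]] := clear_row v; exists m, (\sum_i x i *~ c i) => //.
by case: Mf => fB fx _; rewrite e; apply/rowP => i; rewrite !mxE frame_coord.
Qed.

Variables (N : zmodType) (k : nat) (psi : N -> 'I_k -> rat) (y : 'I_k -> N).
Hypothesis Nf : qframe psi y.

Variable d : M -> N.
Hypothesis dB : zmod_morphism d.

Definition coords_mx : 'M[rat]_(n, k) := \matrix_i coords psi (d (x i)).

(** A nonzero multiple of a is an integral combination of the frame, where the formula holds by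
    additivity; the factor cancels over Q. *)
Lemma coords_mxE a : coords psi (d a) = coords phi a *m coords_mx.
Proof.
case: Mf => fB fx fT; have [m [c m0 e]] := frame_span fB fx fT a.
case: Nf => gB gy gT.
have psiB : zmod_morphism (coords psi) by move=> b b'; apply/rowP => i; rewrite !mxE gB.
apply: (@scalerI _ _ m%:~R); first by rewrite intr_eq0.
rewrite scalemxAl !scaler_int -(zmMz psiB) -(zmMz dB) -(zmMz coordsB) e (zm_sum dB).
rewrite (eq_bigr (fun i => d (x i) *~ c i)) => [|i _]; last by rewrite (zmMz dB).
rewrite (image_coord psiB); congr (_ *m _); apply/rowP => i.
by rewrite !mxE frame_coord.
Qed.

Lemma zrank_range : zrank (fun b => exists a, d a = b) = \rank coords_mx.
Proof.
case: Nf => gB gy gT.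
have psiB : zmod_morphism (coords psi) by move=> b b'; apply/rowP => i; rewrite !mxE gB.
apply: (zrank_image psiB).
- by move=> a e; apply: gT => i; move/rowP: e => /(_ i); rewrite !mxE.
- by move=> _ [a <-]; rewrite coords_mxE submxMl.
move=> _ /submxP[u ->]; have [m [a m0 e]] := coords_onto u.
by exists m, (d a); [split=> //; exists a|rewrite coords_mxE e scalemxAl].
Qed.

End Coords.

Section CohomologyRank.
Variables (L M N : zmodType) (l m n : nat).
Hypotheses (Lr : has_rank L l) (Mr : has_rank M m) (Nr : has_rank N n).
Variables (d0 : L -> M) (d1 : M -> N) (B Z : M -> Prop).
Hypotheses (d0B : zmod_morphism d0) (d1B : zmod_morphism d1).
Hypothesis dd : forall a, d1 (d0 a) = 0.
Hypotheses (BE : forall a, B a <-> exists b, d0 b = a)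
           (ZE : forall a, Z a <-> d1 a = 0).

(** Rank-nullity over Q. Coordinates modulo the row space of [D0] embed the quotient by B up to
    torsion. Up to integer factors, cocycles fill ker [D1] modulo im [D0], whose dimension is m
    minus both ranks because im [D0] lies in ker [D1]. *)
Lemma zrank_cohomology :
  (zrank (fun c : quotby B => exists2 z, Z z & c = class_of B z)
   + zrank (fun b => exists a, d1 a = b) + zrank (fun b => exists a, d0 a = b))%N = m.
Proof.
case: Lr => [lam [x Lf]]; case: Mr => [phi [y Mf]]; case: Nr => [psi [z Nf]].
rewrite (zrank_range Lf Mf d0B) (zrank_range Mf Nf d1B).
set D0 := coords_mx x phi d0; set D1 := coords_mx y psi d1.
have D0E a : coords phi (d0 a) = coords lam a *m D0 by apply: (coords_mxE Lf Mf d0B).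
have D1E a : coords psi (d1 a) = coords phi a *m D1 by apply: (coords_mxE Mf Nf d1B).
have phiB := coordsB Mf; have psiB := coordsB Nf.
have DD : D0 *m D1 = 0.
  apply/row_matrixP => i; rewrite row_mul rowK row0 -D1E dd.
  by rewrite (zm0 psiB).
pose g a := coords phi a *m cokermx D0.
have gB : zmod_morphism g by move=> a b; rewrite /g phiB mulmxBl.
have gR a : B a -> g a = 0.
  by move=> /BE[b <-]; rewrite /g D0E -mulmxA mulmx_coker mulmx0.
pose f (c : quotby B) := g (repr_of c).
have fE a : f (class_of B a) = g a by apply: repr_of_factor.
have fT c : f c = 0 -> torsion c.
  rewrite -(repr_ofK c) fE; move: (repr_of c) => a /eqP; rewrite -submxE.
  case/submxP => u e; have [k [b k0 eb]] := coords_onto Lf u.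
  (* Equal coordinates identify k a with the coboundary of b only up to torsion; one more factor h
     makes it an equality. *)
  have [|h h0 eh] := coords_torsion Mf (a := a *~ k - d0 b).
    by rewrite phiB D0E (zmMz phiB) e eb -scalemxAl scaler_int subrr.
  exists (k * h); first by rewrite mulf_neq0.
  rewrite -(zmMz (@class_ofB _ B)) mulrzA.
  have -> : a *~ k *~ h = d0 (b *~ h).
    by apply/eqP; rewrite -subr_eq0 (zmMz d0B) -mulrzBl eh.
  by apply: class_of_rel; apply/BE; exists (b *~ h).
rewrite (zrank_image (repr_of_factorB gB gR) fT (W := kermx D1 *m cokermx D0)).
- have := mxrank_mul_ker (kermx D1) (cokermx D0).
  have -> : (kermx D1 :&: kermx (cokermx D0) :=: D0)%MS.
    apply/eqmxP/andP; split.
      apply: submx_trans (capmxSr _ _) _.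
      by rewrite submxE; apply/eqP/mulmx_ker.
    by rewrite sub_capmx !sub_kermx DD mulmx_coker !eqxx.
  by rewrite mxrank_ker => e; rewrite addnAC e subnK // rank_leq_row.
- move=> _ [a /ZE a0 ->]; rewrite [X in (X <= _)%MS]fE; apply: submxMr.
  by rewrite sub_kermx -D1E a0 (zm0 psiB).
move=> _ /submxP[u ->]; rewrite mulmxA; set v := u *m _.
have [k [a k0 e]] := coords_onto Mf v.
(* The lift a is a cocycle only up to torsion; multiplying it by h makes it a genuine one. *)
have [|h h0 eh] := coords_torsion Nf (a := d1 a).
  by rewrite D1E e -scalemxAl -mulmxA mulmx_ker mulmx0 scaler0.
exists (k * h), (class_of B (a *~ h)).
  split; first by rewrite mulf_neq0.
  by exists (a *~ h) => //; apply/ZE; rewrite (zmMz d1B).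
by rewrite [LHS]fE /g (zmMz phiB) e -[_ *~ h]scaler_int scalerA -scalemxAl intrM mulrC.
Qed.

End CohomologyRank.

(** * Connectivity and the incidence matrix *)

Section Connectivity.
Variable G : mgraph.
Implicit Types (S T : {set edge G}) (u v : vertex G).

Lemma adj_sym S : ssrbool.symmetric (adj S).
Proof.
by move=> u v; apply/existsP/existsP => -[e /andP[eS h]]; exists e;
  rewrite eS orbC.
Qed.

Lemma adj_connect_sym S : connect_sym (adj S).
Proof. exact/sym_connect_sym/adj_sym. Qed.

Definition spanning_connected S : Prop := forall u v, connect (adj S) u v.

Lemma ncomp_gt0 S v : (0 < ncomp S)%N.
Proof.
apply/card_gt0P; exists (fingraph.root (adj S) v).
by rewrite inE /= andbT roots_root //; apply: adj_connect_sym.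
Qed.

Lemma spanning_connectedP S v : spanning_connected S <-> ncomp S = 1%N.
Proof.
have cs := adj_connect_sym S.
split=> [cS|S1].
  rewrite -(n_comp_connect cs v); apply: eq_n_comp_r => u.
  by rewrite !inE [RHS]cS.
have /card_le1_eqP S1' : (ncomp S <= 1)%N by rewrite S1.
move=> u w; rewrite -root_connect //; apply/eqP.
by apply: S1'; rewrite inE /= andbT roots_root.
Qed.

Lemma spanning_connectedS S T :
  S \subset T -> spanning_connected S -> spanning_connected T.
Proof.
move=> sST cS u v; apply: connect_sub (cS u v) => x y /existsP[e /andP[eS h]].
by apply: connect1; apply/existsP; exists e; rewrite h (fintype.subsetP sST).
Qed.

Lemma connected_vertex : connected G -> inhabited (vertex G).
Proof.
rewrite /connected /ncomp => c1; have : (0 < ncomp [set: edge G])%N by rewrite [ncomp _]c1.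
by case/card_gt0P => v _.
Qed.

(** A set whose removal disconnects G contains a minimal such set, a bond. Conversely, any subset of
    a set with connected complement also has connected complement. *)
Lemma bondfreeP p S : connected G ->
  S \in bondfree G p <-> #|S| = p /\ spanning_connected (~: S).
Proof.
move=> c1; have [v] := connected_vertex c1.
rewrite inE; split=> [/andP[/eqP Sp /forallP Sb]|[/eqP -> cS]].
  split=> //; apply/(spanning_connectedP _ v)/eqP.
  rewrite eqn_leq (ncomp_gt0 _ v) andbT leqNgt; apply/negP => S1.
  have [|B mB BS] := @minset_exists _ [pred A : {set edge G} |
    (ncomp [set: edge G] < ncomp (~: A))%N] S; first by rewrite /= c1.
  by have /implyP/(_ mB) := Sb B; rewrite BS.
apply/forallP => B; apply/implyP => /minsetp /=; apply: contraTN => BS.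
have /(spanning_connectedP _ v) -> : spanning_connected (~: B).
  by apply: spanning_connectedS cS; rewrite finset.setCS.
by rewrite c1.
Qed.

(** Each step of a path contributes its edge with sign +1 or -1, according to the direction in which
    the edge is crossed. *)
Lemma path_chain T u v : connect (adj T) u v ->
  exists2 z : {ffun edge G -> int}, (forall e, e \notin T -> z e = 0) &
    forall w, bdry z w = (u == w)%:R - (v == w)%:R.
Proof.
case/connectP => p.
elim: p u => [|x p IH] u /= => [_ -> |/andP[/existsP[e /andP[eT ue]] xp] vp].
  exists 0 => [e _|w]; first by rewrite ffunE.
  by rewrite ffunE subrr big1 // => e _; rewrite ffunE mul0r.
have [z zT zb] := IH x xp vp.
pose s : int := if (ehead e == u) && (etail e == x) then 1 else -1.
exists (z + [ffun f => s *+ (f == e)]) => [f fT|w].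
  rewrite !ffunE zT // add0r; case: eqP => [fe|//].
  by rewrite fe eT in fT.
rewrite ffunE; under eq_bigr do rewrite !ffunE mulrDl.
rewrite big_split /=; have := zb w; rewrite ffunE => ->.
rewrite (bigD1 e) //= eqxx mulr1n big1 => [|f /negPf ->]; last by rewrite mulr0n mul0r.
rewrite addr0 /s /incidence.
case: ifP ue => [/andP[/eqP -> /eqP ->] _|_ /= /andP[/eqP -> /eqP ->]].
  by rewrite mul1r addrC addrA subrK.
by rewrite mulN1r opprB addrC addrA subrK.
Qed.

End Connectivity.

Section Homology.
Variable G : mgraph.
Hypothesis Gconn : connected G.

Notation E := (edge G).
Notation V := (vertex G).

Definition incidence_mx : 'M[rat]_(#|E|, #|V|) :=
  \matrix_(i, j) (incidence (enum_val i) (enum_val j))%:~R.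

(** A vertex function with zero coboundary agrees at the two ends of every edge, hence along paths,
    hence everywhere by connectivity. *)
Lemma incidence_mx_ker (w : 'rV[rat]_#|V|) :
  w *m incidence_mx^T = 0 <-> exists c, w = const_mx c.
Proof.
have sumE e : \sum_j w 0 j * (incidence e (enum_val j))%:~R =
    w 0 (enum_rank (ehead e)) - w 0 (enum_rank (etail e)).
  have F (u : V) : \sum_j w 0 j * (u == enum_val j)%:R = w 0 (enum_rank u).
    rewrite (bigD1 (enum_rank u)) //= enum_rankK eqxx mulr1 big1 ?addr0 // => j ju.
    case: eqP => [uj|_]; last by rewrite mulr0.
    by rewrite uj enum_valK eqxx in ju.
  rewrite -!F -sumrB; apply: eq_bigr => j _.
  by rewrite /incidence intrB mulrBr; congr (_ * _ - _ * _); case: (_ == _).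
split=> [w0|[c ->]]; last first.
  apply/rowP => i; rewrite !mxE.
  under eq_bigr do rewrite !mxE.
  rewrite -mulr_sumr /incidence.
  rewrite (_ : \sum_j _ = 0) ?mulr0 //.
  have F (u : V) : \sum_(j < #|V|) (u == enum_val j)%:R = 1 :> rat.
    rewrite (bigD1 (enum_rank u)) //= enum_rankK eqxx big1 ?addr0 // => j ju.
    case: eqP => [uj|//].
    by rewrite uj enum_valK eqxx in ju.
  transitivity (\sum_(j < #|V|) (ehead (enum_val i) == enum_val j)%:R
      - \sum_(j < #|V|) (etail (enum_val i) == enum_val j)%:R : rat).
    by rewrite -sumrB; apply: eq_bigr => j _; rewrite intrB; do 2!case: (_ == _).
  by rewrite !F subrr.
have wE e : w 0 (enum_rank (ehead e)) = w 0 (enum_rank (etail e)).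
  apply/eqP; rewrite -subr_eq0 -sumE; apply/eqP.
  move/rowP/(_ (enum_rank e)): w0; rewrite !mxE => {2}<-.
  by apply: eq_bigr => j _; rewrite !mxE enum_rankK.
have [v0] := connected_vertex Gconn.
have /(spanning_connectedP _ v0) cG := Gconn.
exists (w 0 (enum_rank v0)); apply/rowP => j; rewrite mxE -[j]enum_valK.
case/connectP: (cG v0 (enum_val j)) => p; elim: p (v0) => [|x p IH] v /=.
  by move=> _ ->.
case/andP=> /existsP[e /andP[_ he]] xp jp; rewrite (IH _ xp jp).
by case/orP: he => /andP[/eqP <- /eqP <-]; rewrite wE.
Qed.

Lemma incidence_mx_rank : (\rank incidence_mx).+1 = #|V|.
Proof.
have [v0] := connected_vertex Gconn.
have k1 : (kermx incidence_mx^T :=: (const_mx 1 : 'rV[rat]_#|V|))%MS.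
  apply/eqmxP/andP; split.
    apply/row_subP => i; have /incidence_mx_ker[c ->] :
        row i (kermx incidence_mx^T) *m incidence_mx^T = 0.
      by apply/sub_kermxP/row_sub.
    by apply/submxP; exists c%:M; apply/rowP => j; rewrite mul_scalar_mx !mxE mulr1.
  by apply/sub_kermxP/incidence_mx_ker; exists 1.
have := mxrank_ker incidence_mx^T; rewrite k1 mxrank_tr rank_rV.
rewrite (_ : const_mx 1 != 0); last first.
  by apply/eqP => /rowP/(_ (enum_rank v0)); rewrite !mxE => /eqP; rewrite oner_eq0.
have : (0 < #|V|)%N by apply/card_gt0P; exists v0.
have := rank_leq_col incidence_mx; lia.
Qed.

(** The rank is |V| - 1, so the truncated subtraction in [genus] is exact and the genus is the
    dimension of the rational cycle space. *)
Lemma genus_rank : (genus G + \rank incidence_mx)%N = #|E|.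
Proof.
have := rank_leq_row incidence_mx; have := incidence_mx_rank; rewrite /genus; lia.
Qed.

Definition chain_row (z : {ffun E -> int}) : 'rV[rat]_#|E| :=
  \row_i (z (enum_val i))%:~R.

Lemma chain_rowB : zmod_morphism chain_row.
Proof. by move=> a b; apply/rowP => i; rewrite !mxE !ffunE intrB. Qed.

Lemma chain_row_inj a : chain_row a = 0 -> a = 0.
Proof.
move/rowP => a0; apply/ffunP => e; rewrite ffunE; apply/eqP.
by rewrite -(intr_eq0 rat) -[e]enum_rankK; have := a0 (enum_rank e); rewrite !mxE => ->.
Qed.

Lemma chain_row_bdry z j :
  (chain_row z *m incidence_mx) 0 j = (bdry z (enum_val j))%:~R.
Proof.
rewrite mxE ffunE raddf_sum (reindex (@enum_val E E)) /=; last first.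
  by apply: onW_bij; exists enum_rank => ?; rewrite ?enum_valK ?enum_rankK.
by apply: eq_bigr => i _; rewrite !mxE intrM.
Qed.

End Homology.

(** * Rank of the homology and cohomology of a graph *)

Section HomologyRank.
Variable G : mgraph.
Hypothesis Gconn : connected G.

Lemma chain_row_onto (v : 'rV[rat]_#|edge G|) : exists m : int,
  exists2 z, m != 0 & chain_row z = m%:~R *: v.
Proof.
have [m [c m0 e]] := clear_row v; exists m, [ffun e => c (enum_rank e)] => //.
by rewrite e; apply/rowP => i; rewrite !mxE ffunE enum_valK.
Qed.

Lemma bdry0_ker (z : {ffun edge G -> int}) :
  bdry z = 0 <-> chain_row z *m incidence_mx G = 0.
Proof.
split=> [z0|/rowP z0].
  by apply/rowP => j; rewrite chain_row_bdry z0 !mxE ffunE.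
apply/ffunP => w; apply/eqP; have := z0 (enum_rank w).
rewrite chain_row_bdry enum_rankK [RHS]mxE => /eqP; rewrite intr_eq0 => /eqP ->.
by rewrite ffunE.
Qed.

Lemma H1_rank : has_rank (H1 G) (genus G).
Proof.
have -> : genus G = \rank (kermx (incidence_mx G)).
  by rewrite mxrank_ker -[LHS](addnK (\rank (incidence_mx G))) genus_rank.
apply: (@has_rank_image (H1 G) _ (fun z => chain_row (val z))).
- by move=> a b; rewrite -chain_rowB.
- move=> a /chain_row_inj a0; exists 1 => //; rewrite mulr1z.
  exact/val_inj.
- by move=> a; apply/sub_kermxP/bdry0_ker/eqP/(valP a).
move=> v /sub_kermxP v0; have [m [z m0 e]] := chain_row_onto v.
have zc : z \in @cycles G.
  by apply/eqP/bdry0_ker; rewrite e -scalemxAl v0 scaler0.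
by exists m, (H1Cycle zc).
Qed.

Lemma chain_row_cobdry (f : {ffun vertex G -> int}) :
  chain_row (cobdry f) = (\row_j (f (enum_val j))%:~R) *m (incidence_mx G)^T.
Proof.
apply/rowP => i; rewrite !mxE ffunE raddf_sum.
rewrite (reindex (@enum_val (vertex G) (vertex G))) /=; last first.
  by apply: onW_bij; exists enum_rank => ?; rewrite ?enum_valK ?enum_rankK.
by apply: eq_bigr => j _; rewrite !mxE intrM.
Qed.

Lemma Hc1_rank : has_rank (Hc1 G) (genus G).
Proof.
set At := (incidence_mx G)^T.
have -> : genus G = \rank (cokermx At).
  by rewrite mxrank_coker mxrank_tr -[LHS](addnK (\rank (incidence_mx G))) genus_rank.
pose g z := chain_row z *m cokermx At.
have gB : zmod_morphism g by move=> a b; rewrite /g chain_rowB mulmxBl.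
have gR z : (exists f, z = cobdry f) -> g z = 0.
  by move=> [f ->]; rewrite /g chain_row_cobdry -mulmxA mulmx_coker mulmx0.
apply: (has_rank_image (repr_of_factorB gB gR)).
(* An integral cochain that is a rational coboundary has a nonzero multiple that is an integral
   coboundary, so its class is torsion. *)
- move=> c; rewrite -(repr_ofK c) repr_of_factor //; move: (repr_of c) => z /eqP.
  rewrite -submxE => /submxP[u e]; have [m [d m0 em]] := clear_row u.
  exists m => //; rewrite -(zmMz (@class_ofB _ _)); apply: class_of_rel.
  exists [ffun w => d (enum_rank w)]; apply/eqP; rewrite -subr_eq0; apply/eqP.
  apply: chain_row_inj; rewrite chain_rowB (zmMz (@chain_rowB G)) e chain_row_cobdry.
  rewrite -[_ *~ m]scaler_int scalemxAl em.
  rewrite (_ : \row_i (d i)%:~R =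
    \row_j ([ffun w => d (enum_rank w)] (enum_val j))%:~R) ?subrr //.
  by apply/rowP => j; rewrite !mxE ffunE enum_valK.
- by move=> c; rewrite -(repr_ofK c) repr_of_factor // submxMl.
move=> _ /submxP[u ->]; have [m [z m0 e]] := chain_row_onto u.
exists m, (class_of _ z) => //.
by rewrite repr_of_factor // /g e scalemxAl.
Qed.

End HomologyRank.

(** * Deleting edges *)

Section Deletion.
Variable G : mgraph.
Implicit Types S : {set edge G}.

Lemma sum_del (M : nmodType) S (F : edge G -> M) :
  \sum_(e : edge (del S)) F (val e) = \sum_(e | e \notin S) F e.
Proof.
rewrite [RHS](reindex_omap (fun e : edge (del S) => val e) insub) /=.
  by apply: eq_bigl => e; rewrite (valP e) valK eqxx.
by move=> e eS; rewrite insubT.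
Qed.

Lemma card_edge_del S : #|edge (del S)| = (#|edge G| - #|S|)%N.
Proof.
have := sum_del S (fun=> 1%N); rewrite !sum1_card => ->.
rewrite -(cardsC S) addKn.
by apply: eq_card => e; rewrite !inE.
Qed.

Lemma genus_del S : genus (del S) = (genus G - #|S|)%N.
Proof.
by rewrite /genus card_edge_del -subSn ?max_card // -!subnDA addnC.
Qed.

Lemma connected_del S (v : vertex G) : spanning_connected (~: S) -> @connected (del S).
Proof.
move=> cS; apply/(@spanning_connectedP (del S) _ v) => x y.
rewrite (_ : connect _ x y = connect (adj (~: S)) x y) //.
apply: eq_connect => u w; apply/existsP/existsP.
  by move=> [e h]; exists (val e); rewrite inE (valP e); case/andP: h.
move=> [e /andP[+ h]]; rewrite inE => eS.
by exists (exist (fun e => e \notin S) e eS); rewrite inE.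
Qed.

Lemma cks_rank p q r : connected G ->
  has_rank (cks G p q r)
    (#|bondfree G p| * ('C(genus G - p, q) * 'C(genus G - p, r))).
Proof.
move=> c1; have [v] := connected_vertex c1.
have -> : (#|bondfree G p| * ('C(genus G - p, q) * 'C(genus G - p, r)) =
    \sum_(S : bf G p) ('C(genus G - p, q) * 'C(genus G - p, r)))%N.
  by rewrite sum_nat_const card_sig.
apply: dsum_rank => S; have [Sp cS] := (bondfreeP p (val S) c1).1 (valP S).
have cdS := connected_del v cS.
have <- : genus (del (val S)) = (genus G - p)%N by rewrite genus_del Sp.
apply: tensor_rank; apply: ext_rank.
  exact: H1_rank.
exact: Hc1_rank.
Qed.

(* A cycle through e avoiding S \ e, which exists because e is not a bridge of
   the graph with S \ e deleted. *)
Lemma cycle_through S e : e \in S -> spanning_connected (~: S) ->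
  exists c : H1 (del (S :\ e)), coord (val c) e = 1.
Proof.
move=> eS cS; have [z zS zb] := path_chain (cS (ehead e) (etail e)).
pose y : {ffun edge G -> int} := [ffun f => (f == e)%:R - z f].
have yb w : \sum_f y f * incidence f w = 0.
  under eq_bigr do rewrite ffunE mulrBl.
  rewrite sumrB; have := zb w; rewrite ffunE => ->.
  rewrite (bigD1 e) //= eqxx mul1r big1 => [|f /negPf ->]; last by rewrite mul0r.
  by rewrite addr0 subrr.
pose x : {ffun edge (del (S :\ e)) -> int} := [ffun f => y (val f)].
have xc : x \in @cycles (del (S :\ e)).
  apply/eqP/ffunP => w; rewrite !ffunE -[RHS](yb w).
  transitivity (\sum_(f : edge (del (S :\ e))) y (val f) * incidence (val f) w).
    by apply: eq_bigr => f _; rewrite ffunE.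
  rewrite (sum_del _ (fun f => y f * incidence f w)) [RHS](bigID (fun f => f \in S :\ e)) /=.
  rewrite [X in _ = X + _]big1 ?add0r // => f /setD1P[/negPf fe fS].
  by rewrite ffunE fe zS ?subr0 ?mul0r // inE fS.
exists (H1Cycle xc); rewrite /coord /=.
have eD : e \notin S :\ e by rewrite !inE eqxx.
by rewrite insubT /= !ffunE eqxx zS ?subr0 // inE eS.
Qed.

End Deletion.

(** * The interior product along a non-bridge *)

Section Coordinates.
Variable G : mgraph.
Implicit Types S T U : {set edge G}.

Lemma coord_val S (x : {ffun edge (del S) -> int}) (e : edge (del S)) :
  coord x (val e) = x e.
Proof. by rewrite /coord valK. Qed.

Lemma coord_in S (x : {ffun edge (del S) -> int}) e : e \in S -> coord x e = 0.
Proof. by move=> eS; rewrite /coord insubF // eS. Qed.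

Lemma coord_recoord S T (x : {ffun edge (del S) -> int}) e :
  coord (recoord T x) e = if e \in T then 0 else coord x e.
Proof.
case: ifPn => [eT|eT]; first by rewrite coord_in.
by rewrite {1}/coord insubT /= ffunE.
Qed.

(** Vectors on different deletions live on different edge types; comparing them through [coord],
    indexed by all edges of G, avoids transports. *)
Lemma coord_inj S (x y : {ffun edge (del S) -> int}) : coord x =1 coord y -> x = y.
Proof. by move=> xy; apply/ffunP => e; rewrite -!coord_val. Qed.

Lemma coordB S e : zmod_morphism (fun x : {ffun edge (del S) -> int} => coord x e).
Proof.
by move=> x y; rewrite /coord; case: insubP => [f _ _|_] /=; rewrite ?ffunE ?subr0.
Qed.

Lemma recoordB S T : zmod_morphism (@recoord G S T).
Proof. by move=> x y; apply/ffunP => e; rewrite !ffunE coordB. Qed.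

(** An edge dropped by passing through T is either absent from the source or dropped by U anyway. *)
Lemma recoord_recoord S T U (x : {ffun edge (del S) -> int}) :
  T \subset S :|: U -> recoord U (recoord T x) = recoord U x.
Proof.
move=> TSU; apply: coord_inj => e; rewrite !coord_recoord.
case: ifPn => // eU; case: ifPn => // eT; rewrite coord_in //.
by have := fintype.subsetP TSU e eT; rewrite inE (negPf eU) orbF.
Qed.

Lemma bdry_coord S (x : {ffun edge (del S) -> int}) v :
  bdry x v = \sum_e coord x e * @incidence G e v.
Proof.
rewrite ffunE [RHS](bigID (fun e => e \in S)) /= [X in X + _]big1; last first.
  by move=> e eS; rewrite coord_in ?mul0r.
rewrite add0r -(sum_del S (fun e => coord x e * incidence e v)).
by apply: eq_bigr => e _; rewrite coord_val.
Qed.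

Lemma cycles_coord S T (x : {ffun edge (del S) -> int}) (y : {ffun edge (del T) -> int}) :
  coord x =1 coord y -> x \in @cycles (del S) -> y \in @cycles (del T).
Proof.
move=> xy /eqP x0; apply/eqP/ffunP => v; rewrite bdry_coord.
under eq_bigr do rewrite -xy.
by rewrite -bdry_coord x0 !ffunE.
Qed.

(** This makes [Hc1_proj] independent of the chosen representatives. *)
Lemma recoord_cobdry S T (f : {ffun vertex G -> int}) : S \subset T ->
  recoord T (@cobdry (del S) f) = @cobdry (del T) f.
Proof.
move=> ST; apply/ffunP => e; have eS : val e \notin S.
  by apply: contra (valP e); apply: (fintype.subsetP ST).
by rewrite ffunE /coord insubT /= !ffunE.
Qed.

Lemma H1_inclB S T (TS : T \subset S) : zmod_morphism (H1_incl TS).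
Proof. by move=> x y; apply: val_inj; rewrite /= recoordB. Qed.

Lemma H1_coordB S e : zmod_morphism (fun z : H1 (del S) => coord (val z) e).
Proof. by move=> x y; rewrite coordB. Qed.

Lemma H1_incl_comp S T U (TS : T \subset S) (UT : U \subset T) (US : U \subset S) :
  H1_incl UT \o H1_incl TS =1 H1_incl US.
Proof.
move=> z; apply: val_inj; rewrite /= recoord_recoord //.
exact: fintype.subset_trans TS (finset.subsetUl _ _).
Qed.

Section Projection.
Variables S T : {set edge G}.
Hypothesis ST : S \subset T.

Let projR x : (exists f, x = @cobdry (del S) f) ->
  class_of (fun y => exists f, y = @cobdry (del T) f) (recoord T x) = 0.
Proof.
by case=> f ->; apply: class_of_rel; exists f; rewrite recoord_cobdry.
Qed.

Lemma Hc1_proj_class x : Hc1_proj T (class_of _ x : Hc1 (del S)) =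
  class_of _ (recoord T x).
Proof.
exact: (repr_of_factor (zm_comp (@class_ofB _ _) (@recoordB S T)) projR).
Qed.

Lemma Hc1_projB : zmod_morphism (@Hc1_proj G S T).
Proof.
exact: (repr_of_factorB (zm_comp (@class_ofB _ _) (@recoordB S T)) projR).
Qed.

End Projection.

Lemma Hc1_proj_comp S T U : S \subset T -> T \subset U ->
  @Hc1_proj G T U \o @Hc1_proj G S T =1 @Hc1_proj G S U.
Proof.
move=> ST TU c; rewrite /= -(repr_ofK c) !Hc1_proj_class //; last first.
  exact: fintype.subset_trans ST TU.
by rewrite recoord_recoord // (fintype.subset_trans TU) ?finset.subsetUr.
Qed.

End Coordinates.

Section Iota.
Variables (G : mgraph) (S : {set edge G}) (e : edge G).
Hypotheses (eS : e \in S) (cS : spanning_connected (~: S)).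

Let incl := H1_incl (subD1set S e).
Let a (z : H1 (del (S :\ e))) := coord (val z) e.

(** Mere injectivity of [incl] would not suffice for what follows; a left inverse passes to exterior
    powers by functoriality. *)
Lemma H1_retraction : exists c : H1 (del (S :\ e)),
  exists pr : H1 (del (S :\ e)) -> H1 (del S),
  [/\ zmod_morphism pr, cancel incl pr & forall z, incl (pr z) = z - c *~ a z].
Proof.
have [c ce] := cycle_through eS cS; exists c.
have aB : zmod_morphism a by apply: H1_coordB.
pose y z : H1 (del (S :\ e)) := z - c *~ a z.
have ye z : coord (val (y z)) e = 0.
  by rewrite -/(a (y z)) aB (zmMz aB) (_ : a c = 1) // intz subrr.
have yC z : coord (recoord S (val (y z))) =1 coord (val (y z)).
  move=> f; rewrite coord_recoord; case: ifPn => // fS.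
  have [->|fe] := eqVneq f e; first by rewrite ye.
  by rewrite coord_in // !inE fe.
have yc z : recoord S (val (y z)) \in @cycles (del S).
  by apply: (@cycles_coord _ (S :\ e)) (valP (y z)) => f; rewrite yC.
pose pr z := H1Cycle (yc z).
have inclE z : incl (pr z) = y z.
  apply: val_inj; apply: coord_inj => f; rewrite coord_recoord yC.
  by case: ifP => // fS; rewrite coord_in.
have incl_inj : injective incl.
  move=> z z' /(congr1 val) /= zz; apply: val_inj; apply: coord_inj => f.
  have := congr1 (fun x => coord x f) zz; rewrite !coord_recoord.
  by case: ifP => // /setD1P[_ fS]; rewrite !coord_in.
have inclB : zmod_morphism incl by apply: H1_inclB.
exists pr; split=> // [z z'|z]; apply: incl_inj; rewrite inclE.
  by rewrite inclB !inclE /y aB mulrzBr subr_interchange.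
rewrite /y (_ : a _ = 0) ?mulr0z ?subr0 //.
by rewrite /a coord_recoord !inE eqxx /= coord_in.
Qed.

Lemma ext_incl_inj q : injective (@ext_map q _ _ incl).
Proof.
have [c [pr [prB prK _]]] := H1_retraction.
apply: (can_inj (g := ext_map pr)) => w.
rewrite ext_map_comp //; last exact: H1_inclB.
rewrite (eq_ext_map (g := id)) ?ext_map_id //.
exact: zm_comp prB (@H1_inclB _ _ _ _).
Qed.

(** The preimage is obtained by applying the retraction to the contraction: [incl] after [pr] is the
    projection along c, which fixes contractions. *)
Lemma iotaP q w : ext_map incl (@iota G q S e w) = iprod a w.
Proof.
have [c [pr [prB _ prE]]] := H1_retraction.
apply: (classical_sets.xgetPex 0 (P := fun w' => ext_map incl w' = iprod a w)).
have aB : zmod_morphism a by apply: H1_coordB.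
have inclB : zmod_morphism incl by apply: H1_inclB.
exists (ext_map pr (iprod a w)); rewrite ext_map_comp //.
rewrite (eq_ext_map (g := fun z => z - c *~ a z)) //; last exact: zm_comp.
exact: ext_map_proj_iprod.
Qed.

(** As [iota] is defined by choice, its additivity comes from the uniqueness of the preimage. *)
Lemma iotaB q : zmod_morphism (@iota G q S e).
Proof.
have inclB : zmod_morphism incl by apply: H1_inclB.
move=> x y; apply: ext_incl_inj; rewrite (ext_mapB inclB) !iotaP iprodB //.
exact: H1_coordB.
Qed.

Lemma cks_compB q r : zmod_morphism (@cks_comp G q r S e).
Proof. by apply: tens_mapB (@iotaB q) (ext_mapB (Hc1_projB (subD1set S e))). Qed.

End Iota.

(** * The differential squares to zero *)

Section DoubleIota.
Variables (G : mgraph).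
Implicit Types (S T : {set edge G}) (e f : edge G).

(* The composite of iota_f and iota_e from Gamma \ T to Gamma \ S, for
   S = T + e + f; unlike that composite, its type does not depend on the order
   in which e and f are removed from S. *)
Definition iota2 q S T e f (w : ext q.+2 (H1 (del T))) : ext q (H1 (del S)) :=
  classical_sets.xget 0 (fun w' => forall TS : T \subset S,
    ext_map (H1_incl TS) w' =
    iprod (fun z : H1 (del T) => coord (val z) e)
      (iprod (fun z : H1 (del T) => coord (val z) f) w)).

Definition comp2 q r S T e f : cks_summand q.+2 r T -> cks_summand q r S :=
  tens_map (@iota2 q S T e f) (ext_map (@Hc1_proj G T S)).

Section Pair.
Variables (S : {set edge G}) (e f : edge G).
Hypotheses (eS : e \in S) (fS : f \in S :\ e) (cS : spanning_connected (~: S)).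

Let cSe : spanning_connected (~: (S :\ e)).
Proof. by apply: spanning_connectedS cS; rewrite finset.setCS subD1set. Qed.

Let TS : S :\ e :\ f \subset S.
Proof. exact: fintype.subset_trans (subD1set _ _) (subD1set _ _). Qed.

Let incl_comp q (w : ext q (H1 (del S))) :
  ext_map (H1_incl TS) w =
  ext_map (H1_incl (subD1set (S :\ e) f)) (ext_map (H1_incl (subD1set S e)) w).
Proof.
rewrite ext_map_comp; [|exact: H1_inclB|exact: H1_inclB].
by apply: eq_ext_map => [|z]; [exact: H1_inclB|rewrite (H1_incl_comp _ _ TS)].
Qed.

Let incl2_inj q : injective (@ext_map q _ _ (H1_incl TS)).
Proof.
by move=> w w'; rewrite !incl_comp => /(ext_incl_inj fS cSe)/(ext_incl_inj eS cS).
Qed.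

(** Extension by zero preserves the e-coordinate, so contraction by e commutes with the inclusion
    and both contractions can be carried out at S :\ e :\ f. *)
Lemma iota_iota q w :
  ext_map (H1_incl TS) (@iota G q S e (@iota G q.+1 (S :\ e) f w)) =
  iprod (fun z : H1 (del (S :\ e :\ f)) => coord (val z) e)
    (iprod (fun z : H1 (del (S :\ e :\ f)) => coord (val z) f) w).
Proof.
rewrite incl_comp iotaP // -(iotaP fS cSe) iprod_ext_map; first last.
- exact: H1_coordB.
- exact: H1_inclB.
congr ext_map; congr (iprod _ _); apply: boolp.funext => z /=.
by rewrite coord_recoord !inE eqxx andbF.
Qed.

Let iota2_unique q a b w w' :
  ext_map (H1_incl TS) w' =
    iprod (fun z : H1 (del (S :\ e :\ f)) => coord (val z) a)
      (iprod (fun z : H1 (del (S :\ e :\ f)) => coord (val z) b) w) ->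
  @iota2 q S (S :\ e :\ f) a b w = w'.
Proof.
move=> w'E; apply: classical_sets.xget_unique => [TS'|w'' /(_ TS) w''E].
  by rewrite (bool_irrelevance TS' TS).
by apply: incl2_inj; rewrite w''E w'E.
Qed.

Lemma iota2E q w :
  @iota2 q S (S :\ e :\ f) e f w = @iota G q S e (@iota G q.+1 (S :\ e) f w).
Proof. exact/iota2_unique/iota_iota. Qed.

(** Anticommutation of contractions, pulled back along the injection into the exterior power at S :\
    e :\ f. *)
Lemma iota2N q w : @iota2 q S (S :\ e :\ f) f e w = - @iota2 q S (S :\ e :\ f) e f w.
Proof.
apply: iota2_unique; rewrite (zmN (ext_mapB (@H1_inclB _ _ _ TS))) iota2E iota_iota.
apply/eqP; rewrite eq_sym -addr_eq0; apply/eqP/iprodC; exact: H1_coordB.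
Qed.

Let iota2B q : zmod_morphism (@iota2 q S (S :\ e :\ f) e f).
Proof.
by move=> w w'; rewrite !iota2E (iotaB fS cSe) (iotaB eS cS).
Qed.

Lemma comp2E q r u : @comp2 q r S (S :\ e :\ f) e f u =
  @cks_comp G q r S e (@cks_comp G q.+1 r (S :\ e) f u).
Proof.
have pB := ext_mapB (q := r) (Hc1_projB TS).
have p1B := ext_mapB (q := r) (Hc1_projB (subD1set S e)).
have p2B := ext_mapB (q := r) (Hc1_projB (subD1set (S :\ e) f)).
move: u; apply: tens_eq.
- exact: tens_mapB (@iota2B q) pB.
- exact: (zm_comp (@cks_compB _ _ _ eS cS q r) (@cks_compB _ _ _ fS cSe q.+1 r)).
move=> a b; rewrite /cks_comp /comp2 !tens_map_gen //;
  do ?[exact: iotaB|exact: iota2B].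
rewrite -iota2E; congr tens; rewrite ext_map_comp //.
- by apply: eq_ext_map => [|c]; [exact: Hc1_projB|rewrite Hc1_proj_comp // subD1set].
- exact: (Hc1_projB (subD1set S e)).
- exact: (Hc1_projB (subD1set (S :\ e) f)).
Qed.

(** The map on the H^1 factor is the same for both orders, so the sign of [iota2] passes to the
    tensor product. *)
Lemma comp2N q r u : @comp2 q r S (S :\ e :\ f) e f u +
  @comp2 q r S (S :\ e :\ f) f e u = 0.
Proof.
have pB := ext_mapB (q := r) (Hc1_projB TS).
have iB : zmod_morphism (@iota2 q S (S :\ e :\ f) f e).
  by move=> w w'; rewrite !iota2N iota2B opprB opprK addrC.
move: u; apply: tens_eq.
- by apply: zm_add; apply: tens_mapB.
- by move=> ? ?; rewrite subrr.
move=> a b; rewrite /comp2 !tens_map_gen // iota2N.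
by rewrite (zmN (tensB_l _)) subrr.
Qed.

End Pair.
End DoubleIota.

(** Ordering the indices pairs (i, j) with (j, i), so the terms cancel in pairs and no division by
    2, impossible in a general M, is involved. *)
Lemma big_antisym (M : zmodType) (I : finType) (A : {set I}) (H : I -> I -> M) :
  (forall i j, i \in A -> j \in A :\ i -> H i j + H j i = 0) ->
  \sum_(i in A) \sum_(j in A :\ i) H i j = 0.
Proof.
move=> HA; pose lt (i j : I) := (enum_rank i < enum_rank j)%N.
have split i : \sum_(j in A :\ i) H i j =
    \sum_(j in A | lt i j) H i j + \sum_(j in A | lt j i) H i j.
  rewrite (bigID (lt i)) /=; congr (_ + _); apply: eq_bigl => j; rewrite !inE /lt.
    by case: eqVneq => [->|]; rewrite ?ltnn ?andbF.
  have [->|ji] := eqVneq j i; first by rewrite ltnn !andbF.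
  by rewrite -leqNgt leq_eqVlt (inj_eq val_inj) (inj_eq enum_rank_inj) (negPf ji).
under eq_bigr do rewrite split.
rewrite big_split /= [X in _ + X](exchange_big_dep (mem A)) /=; last by move=> i j _ /andP[].
rewrite -big_split /= big1 // => i iA.
rewrite [X in _ + X](eq_bigl (fun j => (j \in A) && lt i j)); last first.
  by move=> j; rewrite iA.
rewrite -big_split /= big1 // => j /andP[jA ij]; apply: HA => //.
rewrite !inE jA andbT; apply: contraTneq ij => ->; by rewrite /lt ltnn.
Qed.

Lemma sum_sig_in (M : nmodType) (I : finType) (A : {set I}) (F : I -> M) :
  \sum_(i : {i | i \in A}) F (val i) = \sum_(i in A) F i.
Proof.
rewrite [RHS](reindex_omap (fun i : {i | i \in A} => val i) insub) /=.
  by apply: eq_bigl => i; rewrite (valP i) valK eqxx.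
by move=> i iA; rewrite insubT.
Qed.

Section Differential.
Variables (G : mgraph) (Gconn : connected G).

Lemma bf_connected p (S : bf G p) : spanning_connected (~: val S).
Proof. by have [] := (bondfreeP p (val S) Gconn).1 (valP S). Qed.

Lemma cks_diffB p q r : zmod_morphism (@cks_diff G p q r).
Proof.
move=> x y; apply/ffunP => S; rewrite !ffunE -sumrB; apply: eq_bigr => e _.
by rewrite dsum_projB (cks_compB (valP e) (bf_connected S)).
Qed.

Lemma cks_diff_sq p q r (x : cks G p q.+2 r) : cks_diff (cks_diff x) = 0.
Proof.
apply/ffunP => S; rewrite !ffunE; have cS := bf_connected S.
(* The summand is looked up from the bare set, so H makes sense for all pairs of edges and S :\ e :\
   f can be rewritten as S :\ f :\ e. The default 0 is never met for e in S and f in S :\ e. *)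
pose H e f := if insub (val S :\ e :\ f) is Some U
  then @comp2 G q r (val S) (val (U : bf G p)) e f (x U) else 0.
have HE (e : {e | e \in val S}) (f : {f | f \in val (bf_del e)}) :
    H (val e) (val f) = comp2 (val S) (val e) (val f) (x (bf_del f)).
  by rewrite /H (valK (bf_del f)).
transitivity (\sum_(e in val S) \sum_(f in val S :\ e) H e f).
  rewrite -sum_sig_in; apply: eq_bigr => e _.
  rewrite ffunE (zm_sum (@cks_compB _ _ _ (valP e) cS q r)) -sum_sig_in; apply: eq_bigr => f _.
  by rewrite HE; symmetry; apply: (comp2E (valP e) (valP f) cS).
apply: big_antisym => e f eS fS.
pose e' : {e | e \in val S} := exist _ e eS.
pose f' : {f | f \in val (bf_del e')} := exist _ f fS.
have -> : H f e = comp2 (val S) f e (x (bf_del f')).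
  by rewrite /H finset.setDDl finset.setUC -finset.setDDl (valK (bf_del f')).
by rewrite (HE e' f'); apply: comp2N.
Qed.

End Differential.

(** * The Euler characteristic *)

(** At the ends of the complex a zero map stands for the missing differential, and its range must
    contribute rank 0. *)
Lemma zrank_zero (L M : zmodType) : zrank (fun b : M => exists a : L, 0 = b) = 0%N.
Proof.
apply: is_zrank_zrank; split=> [|m x x0 xi].
  by exists (fun=> 0); split=> [[]|? ? []].
rewrite leqNgt; apply/negP => m0.
have x1 : \sum_i x i *~ 1 = 0.
  by apply: big1 => i _; have [_ <-] := x0 i; rewrite mul0rz.
by have /eqP := xi (fun=> 1) x1 (Ordinal m0); rewrite oner_eq0.
Qed.

Section EulerCharacteristic.
Variables (G : mgraph) (Gconn : connected G).
Let d := genus G.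

(** A connected spanning subgraph has at least |V| - 1 edges, so at most d edges can be deleted. *)
Lemma bondfree_genus p (S : {set edge G}) : S \in bondfree G p ->
  (p <= d)%N /\ spanning_connected (~: S).
Proof.
move=> /(bondfreeP p S Gconn)[Sp cS]; split=> //.
have [v] := connected_vertex Gconn; have cdS := connected_del v cS.
have Ed : #|edge (del S)| = (#|edge G| - p)%N by rewrite card_edge_del Sp.
have := genus_rank cdS; have := incidence_mx_rank cdS.
have := genus_rank Gconn; have := incidence_mx_rank Gconn.
have : (p <= #|edge G|)%N by rewrite -Sp max_card.
move: (\rank (incidence_mx G)) (\rank (incidence_mx (del S))) (genus (del S)) Ed.
change #|vertex (del S)| with #|vertex G|; rewrite -/d; lia.
Qed.

Let N l p q := (#|bondfree G p| * ('C(d - p, q) * 'C(d - p, l)))%N.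

Let R l p q := zrank (fun b => exists a, @cks_diff G p q l a = b).
(** Ranks of the differentials leaving and entering position (p, q), read as 0 at the ends of the
    complex. *)
Let dout l p q := if q is q'.+1 then R l p q' else 0%N.
Let din l p q := if p is p'.+1 then R l p' q else 0%N.

(** The case split lets [cocycle] and [coboundary] compute. At an end, the missing neighbour is
    replaced by the group itself with a zero map. *)
Lemma cohomology_rank l p q :
  (zrank (@cohomology G p q l) + dout l p q + din l p q)%N = N l p q.
Proof.
have rk p' q' : has_rank (cks G p' q' l) (N l p' q') := cks_rank p' q' l Gconn.
have dB := cks_diffB Gconn; have dd := cks_diff_sq Gconn.
have z0 (L M : zmodType) : zmod_morphism (fun _ : L => 0 : M) by move=> ? ?; rewrite subrr.
have dd0 p' q' r' : @cks_diff G p' q' r' 0 = 0 by apply: zm0.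
case: p q => [|p] [|q] /=.
- have := @zrank_cohomology (cks G 0 0 l) (cks G 0 0 l) (cks G 0 0 l) _ _ _
    (rk _ _) (rk _ _) (rk _ _) (fun=> 0) (fun=> 0) (@coboundary G 0 0 l)
    (@cocycle G 0 0 l) (z0 _ _) (z0 _ _) (fun=> erefl).
  rewrite zrank_zero; apply=> a /=; last by split.
  by split=> [->|[_ <-] //]; exists 0.
- have := @zrank_cohomology (cks G 0 q.+1 l) (cks G 0 q.+1 l) (cks G 1 q l) _ _ _
    (rk _ _) (rk _ _) (rk _ _) (fun=> 0) (@cks_diff G 0 q l) (@coboundary G 0 q.+1 l)
    (@cocycle G 0 q.+1 l) (z0 _ _) (dB _ _ _) (fun=> dd0 _ _ _).
  rewrite zrank_zero; apply=> a //=.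
  by split=> [->|[_ <-] //]; exists 0.
- have := @zrank_cohomology (cks G p 1 l) (cks G p.+1 0 l) (cks G p.+1 0 l) _ _ _
    (rk _ _) (rk _ _) (rk _ _) (@cks_diff G p 0 l) (fun=> 0) (@coboundary G p.+1 0 l)
    (@cocycle G p.+1 0 l) (dB _ _ _) (z0 _ _) (fun=> erefl).
  by rewrite zrank_zero; apply=> a //=; split.
exact: (@zrank_cohomology (cks G p q.+2 l) (cks G p.+1 q.+1 l) (cks G p.+2 q l) _ _ _
    (rk _ _) (rk _ _) (rk _ _) (@cks_diff G p q.+1 l) (@cks_diff G p.+1 q l)
    (@coboundary G p.+1 q.+1 l) (@cocycle G p.+1 q.+1 l) (dB _ _ _) (dB _ _ _)
    (fun=> dd _ _ _ _)).
Qed.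

(** The rank leaving p is the rank entering p + 1, with opposite sign in the alternating sum, so all
    ranks of differentials cancel. *)
Lemma eta_euler k l : eta G k l =
  \sum_(p < k.+1) (-1) ^+ p *
    (#|bondfree G p| * ('C(d - p, k - p) * 'C(d - p, l)))%:Z.
Proof.
apply/eqP; rewrite eq_sym -subr_eq0 -sumrB.
have E (p : 'I_k.+1) : (-1) ^+ p * (N l p (k - p))%:Z
    - (-1) ^+ p * (zrank (@cohomology G p (k - p) l))%:Z
    = (-1) ^+ p * (dout l p (k - p))%:Z + (-1) ^+ p * (din l p (k - p))%:Z.
  rewrite -mulrBr -mulrDr -(cohomology_rank l p (k - p)) !PoszD; congr (_ * _).
  by rewrite addrAC [_ + _ - _]addrAC subrr add0r.
rewrite (eq_bigr _ (fun p _ => E p)) big_split /=.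
(* The end terms vanish: nothing leaves p = k, where q = 0, and nothing enters p = 0. *)
rewrite [X in X + _]big_ord_recr [X in _ + X]big_ord_recl /= subnn mulr0 mulr0 addr0 add0r.
rewrite -big_split big1 // => p _ /=.
have -> : (k - p = (k - bump 0 p).+1)%N by have := ltn_ord p; rewrite /bump; lia.
by rewrite /= /bump add1n exprS mulN1r mulNr subrr.
Qed.

Lemma eta_vanish k l : (d < k)%N || (d < l)%N -> eta G k l = 0.
Proof.
move=> kl; rewrite eta_euler big1 // => p _.
(* For p > d the truncated d - p is 0 and the binomials need not vanish, but then F_p is empty. *)
have [->|[S Sp]] := set_0Vmem (bondfree G p); first by rewrite cards0 mulr0.
have [pd _] := bondfree_genus Sp; case/orP: kl => [dk|dl].
  rewrite (@bin_small (d - p) (k - p)) ?mul0n ?muln0 ?mulr0 //.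
  by rewrite ltn_sub2r // (leq_ltn_trans pd).
by rewrite (@bin_small (d - p) l) ?muln0 ?mulr0 // (leq_ltn_trans (leq_subr _ _)).
Qed.

End EulerCharacteristic.

(** * Expanding powers of (1 + x)(1 + y) *)

Section BinomialIdentity.
Variables (A : comNzRingType) (x y : A) (d : nat).

Lemma expr1D_widen n : (n <= d)%N ->
  (1 + y) ^+ n = \sum_(l < d.+1) 'C(n, l)%:R * y ^+ l.
Proof.
move=> nd; rewrite addrC exprD1n (big_ord_widen d.+1 (fun l => y ^+ l *+ 'C(n, l))) //.
rewrite big_mkcond; apply: eq_bigr => l _; rewrite mulr_natl.
by case: ltnP => // nl; rewrite bin_small.
Qed.

(** Reversing the summation index turns exponents into d - k; the symmetry of binomial coefficients
    then replaces d - k by k - p in the coefficient. *)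
Lemma expr1D_rev p : (p <= d)%N ->
  (1 + y) ^+ (d - p) = \sum_(k < d.+1 | (p <= k)%N) 'C(d - p, k - p)%:R * y ^+ (d - k).
Proof.
move=> pd; rewrite expr1D_widen ?leq_subr // (reindex_inj rev_ord_inj) /=.
rewrite [RHS]big_mkcond; apply: eq_bigr => k _ /=; rewrite subSS.
have kd : (k <= d)%N by rewrite -ltnS.
case: leqP => [pk|kp]; last by rewrite bin_small ?mul0r //; lia.
rewrite -(@bin_sub (d - p) (k - p)) ?leq_sub2r //; congr ('C(_, _)%:R * _).
lia.
Qed.

End BinomialIdentity.

(** The powers of 1 + x and 1 + y contribute the two binomials, and (-1)^(d - p) splits as (-1)^d
    (-1)^p; exchanging the sums leaves p <= k. *)
Lemma binomial_euler (A : comNzRingType) (x y : A) d (f : nat -> nat) :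
  \sum_(p < d.+1) (f p)%:R * (- ((1 + x) * (1 + y))) ^+ (d - p) =
  (-1) ^+ d * \sum_(k < d.+1) \sum_(l < d.+1)
    (\sum_(p < k.+1) (-1) ^+ p *
       (f p * ('C(d - p, k - p) * 'C(d - p, l)))%:Z)%:~R * (x ^+ (d - k) * y ^+ l).
Proof.
pose F (p k l : nat) : A := (-1) ^+ d * ((-1) ^+ p * (f p)%:R *
  (('C(d - p, k - p)%:R * x ^+ (d - k)) * ('C(d - p, l)%:R * y ^+ l))).
transitivity (\sum_(p < d.+1) \sum_(k < d.+1 | (p <= k)%N) \sum_(l < d.+1) F p k l).
  apply: eq_bigr => p _; have pd : (p <= d)%N by rewrite -ltnS.
  rewrite exprNn exprMn (expr1D_rev x pd) (expr1D_widen y (leq_subr p d)).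
  have -> : (-1) ^+ (d - p) = (-1) ^+ d * (-1) ^+ p :> A.
    by rewrite -signr_odd oddB // signr_addb !signr_odd.
  rewrite mulrCA mulr_suml !mulr_sumr; apply: eq_bigr => k _.
  by rewrite !mulr_sumr; apply: eq_bigr => l _; rewrite /F; ring.
rewrite (exchange_big_dep xpredT) //= mulr_sumr; apply: eq_bigr => k _.
rewrite exchange_big /= mulr_sumr; apply: eq_bigr => l _.
pose c p : A := ((-1) ^+ p * (f p * ('C(d - p, k - p) * 'C(d - p, l)))%:Z)%:~R.
rewrite (_ : (\sum_(p < k.+1) _)%:~R = \sum_(p < k.+1) c p); last exact: raddf_sum.
rewrite (big_ord_widen d.+1 c) // mulr_suml mulr_sumr; apply: eq_bigr => p _.
rewrite /c /F intrM rmorphXn /= rmorphN1 -pmulrn !natrM; ring.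
Qed.

(** * Specialization of the Tutte polynomial *)

(** With the first variable sent to 1, the factor 0^(k(S) - 1) keeps exactly the connected spanning
    S, by 0^0 = 1; their complements are then sorted by size. *)
Lemma tutte_comp (G : mgraph) (A : comNzRingType) (h : {rmorphism {mpoly int[2]} -> A}) :
  connected G -> h 'X_ord0 = 1 ->
  h (tutte G) = \sum_(p < (genus G).+1)
    (#|bondfree G p|)%:R * (h 'X_ord_max - 1) ^+ (genus G - p).
Proof.
move=> Gconn h1; have [v] := connected_vertex Gconn; set z := h 'X_ord_max - 1.
have term (S : {set edge G}) : h (('X_ord0 - 1) ^+ (ncomp S - ncomp [set: edge G])
    * ('X_ord_max - 1) ^+ (ncomp S + #|S| - #|vertex G|)) =
    if ncomp S == 1%N then z ^+ (genus G - #|~: S|) else 0.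
  rewrite rmorphM !rmorphXn !rmorphB !rmorph1 h1 subrr -/z expr0n.
  rewrite [ncomp [set: _]]Gconn subn_eq0.
  have S0 := ncomp_gt0 S v; have [->|S1] := eqVneq (ncomp S) 1%N.
    (* The exponent |S| + 1 - |V| equals d minus the number of deleted edges. *)
    rewrite mul1r; congr (z ^+ _); have := cardsC S; rewrite /genus; lia.
  by rewrite leqNgt ltn_neqAle eq_sym S1 S0 mul0r.
rewrite /tutte rmorph_sum (eq_bigr _ (fun S _ => term S)).
rewrite (reindex_inj (inv_inj (@finset.setCK (edge G)))) /=.
under eq_bigr do rewrite finset.setCK.
rewrite -big_mkcond /=.
transitivity (\sum_(p < (genus G).+1) \sum_(S in bondfree G p) z ^+ (genus G - p)); last first.
  by apply: eq_bigr => p _; rewrite sumr_const mulr_natl.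
have mem p (S : {set edge G}) : (S \in bondfree G p) = (ncomp (~: S) == 1%N) && (#|S| == p).
  apply/idP/idP => [Sp|/andP[/eqP/(spanning_connectedP _ v) cS /eqP Sp]].
    have [-> cS] := (bondfreeP p S Gconn).1 Sp.
    by rewrite (spanning_connectedP _ v).1 // !eqxx.
  exact/(bondfreeP _ _ Gconn).
rewrite (exchange_big_dep (fun S => ncomp (~: S) == 1%N)) /=; last first.
  by move=> p S _; rewrite mem => /andP[].
apply: eq_bigr => S cS.
have Sb : S \in bondfree G #|S| by rewrite mem cS eqxx.
have [Sg _] := bondfree_genus Gconn Sb.
rewrite (big_pred1 (Ordinal (Sg : #|S| < (genus G).+1)%N)) // => p.
by rewrite mem cS /= -val_eqE eq_sym.
Qed.

(** The vanishing clause makes the sum over k, l <= d the full sum over natural numbers; within that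
    range d - k is never truncated. *)
Theorem mainTheorem2 (G : mgraph) (Gconn : connected G) :
  let d := genus G in
  let x : {mpoly int[2]} := 'X_ord0 in
  let y : {mpoly int[2]} := 'X_ord_max in
  (forall k l : nat, (d < k)%N || (d < l)%N -> eta G k l = 0) /\
  comp_mpoly [tuple 1; - (x + y + x * y)] (tutte G)
    = (-1) ^+ d *
      \sum_(k < d.+1) \sum_(l < d.+1) eta G k l *: (x ^+ (d - k) * y ^+ l).
Proof.
move=> d x y; split; first exact: eta_vanish.
pose h : {rmorphism {mpoly int[2]} -> {mpoly int[2]}} :=
  comp_mpoly [tuple 1; - (x + y + x * y)].
rewrite (tutte_comp (h := h)) //; last by rewrite /h /= comp_mpolyXU.
have -> : h 'X_ord_max - 1 = - ((1 + x) * (1 + y)).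
  by rewrite /h /= comp_mpolyXU /=; ring.
rewrite (binomial_euler x y d (fun p => #|bondfree G p|)); congr (_ * _).
apply: eq_bigr => k _; apply: eq_bigr => l _.
by rewrite eta_euler // -[RHS]mul_mpolyC -[X in X%:MP]intz rmorph_int.
Qed.
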